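(* Let $\lambda>0$ and $a\in[0,1]$, and let $P_n(x;a|q)$, $q\in(0,1)$, be the little $q$-Laguerre polynomials, so that $$P_n(-x;a|q)=\sum_{k=0}^n\left(\prod_{l=1}^k\frac{q^{l-n}-q}{(1-aq^l)(1-q^l)}\right)x^k .$$ Then, as $n\to\infty$, the empirical zero distributions $[\![P_n(-x;a|e^{-\lambda/n})]\!]_n$ converge weakly to $\mu_{a|\lambda}(-\,\cdot\,)$, where $\mu_{a|\lambda}$ is a probability measure on $[0,+\infty)$ and $\mu_{a|\lambda}(-\,\cdot\,)$ is its reflection at the origin. The Cauchy transform $G^-_{a|\lambda}$ of $\mu_{a|\lambda}(-\,\cdot\,)$ is such that $t\mapsto tG^-_{a|\lambda}(t)$, $t>0$, is the inverse of $$(0,1)\ni\alpha\mapsto\frac{(1-ae^{-\lambda\alpha})(1-e^{-\lambda\alpha})}{e^{\lambda}e^{-\lambda\alpha}-1}.$$ With $$t_\pm=e^{-\lambda}\left(\sqrt{1-ae^{-\lambda}}\pm\sqrt{a(1-e^{-\lambda})}\right)^2,$$ the measure $\mu_{a|\lambda}$ has the Lebesgue density $$p_{a|\lambda}(x)=\begin{cases}\dfrac{1}{\lambda x},&\text{if }x\in[t_+,1]\text{ and }\lambda>\log(1+a),\\[2mm]\dfrac{1}{\lambda\pi x}\arg\left(a+1-e^{\lambda}x+e^{\lambda}\,\mathrm{i}\,\sqrt{(x-t_-)(t_+-x)}\right),&\text{if }x\in[t_-,t_+],\\[2mm]0,&\text{otherwise.}\end{cases}$$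
   Context: For a polynomial $P\not\equiv0$ of degree at most $n$, $[\![P]\!]_n:=\frac1n\sum_{z\in\mathbb{C}:P(z)=0}\delta_z+\frac{n-\deg P}{n}\delta_\infty$ (zeros counted with multiplicity) is the empirical distribution of zeros. The polynomial $x\mapsto P_n(-x;a|q)$ has only real nonpositive zeros; in general $P_n(x;a|q)={}_2\phi_1(q^{-n},0;aq;q,qx)$ in standard $q$-hypergeometric notation. The Cauchy transform of a probability measure $\mu$ on $(-\infty,0]$ is $G(t)=\int\frac{\mu(\mathrm{d}z)}{t-z}$. $\arg$ is the principal argument (so in $[0,\pi]$ for numbers with nonnegative imaginary part). The density formula is understood up to Lebesgue-null sets (e.g. at endpoints of the intervals). *)

(* Defs.v *)
From HB Require Import structures.
From mathcomp Require Import all_boot all_order all_algebra.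
From mathcomp Require Import complex.
From mathcomp Require Import all_classical all_reals all_analysis.
From mathcomp Require Import ring lra.

Set Implicit Arguments.
Unset Strict Implicit.
Unset Printing Implicit Defensive.

Import Order.TTheory GRing.Theory Num.Theory.
Import numFieldNormedType.Exports.

Local Open Scope classical_set_scope.
Local Open Scope ring_scope.

Section little_q_Laguerre.
Context {R : fieldType}.

Definition qpochhammer (a q : R) (k : nat) : R :=
  \prod_(i < k) (1 - a * q ^+ i).

Definition phi21_coef (a b c q : R) (k : nat) : R :=
  qpochhammer a q k * qpochhammer b q k /
  (qpochhammer c q k * qpochhammer q q k).

(* P_n(x;a|q) = 2phi1(q^-n, 0; aq; q, qx): the series terminates, because
   (q^-n;q)_k = 0 for k > n, and is thus a polynomial in x. *)
Definition little_qLaguerre (n : nat) (a q : R) : {poly R} :=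
  \sum_(k < n.+1) phi21_coef (q ^- n) 0 (a * q) q k *: (q *: 'X) ^+ k.

End little_q_Laguerre.

Definition borel (T : ptopologicalType) := g_sigma_algebraType (@open T).

Section weak_convergence.
Context {R : realType} {T : ptopologicalType}.

Definition weakly_converges (mu_ : nat -> {measure set (borel T) -> \bar R})
    (mu : {measure set (borel T) -> \bar R}) : Prop :=
  forall f : T -> R, continuous f -> (exists M, forall x, `|f x| <= M) ->
    (\int[mu_ n]_x (f x)%:E)%E @[n --> \oo] --> (\int[mu]_x (f x)%:E)%E.

End weak_convergence.

(* R[i] only gets its (norm) topology through the alias R[i]^o. *)
Notation sphere R := (one_point_compactification (complex R)^o).

Section empirical_distribution.
Context {R : realType}.

(* The zeros of p != 0, repeated according to their multiplicities. *)
Definition zeros (p : {poly R[i]}) : seq R[i] :=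
  sval (closed_field_poly_normal p).

Definition zeros_msum (p : {poly R[i]}) :
    {measure set (borel (sphere R)) -> \bar R} :=
  msum (fun i => dirac (Some (zeros p)`_i : borel (sphere R))) (size (zeros p)).

(* [[p]]_n, as a measure on the Riemann sphere; (size p).-1 is deg p. *)
Definition empirical_zeros (n : nat) (p : {poly R[i]}) :
    {measure set (borel (sphere R)) -> \bar R} :=
  mscale (n%:R^-1)%:nng (measure_add (zeros_msum p)
    (mscale ((n - (size p).-1)%:R)%:nng (dirac (None : borel (sphere R))))).

End empirical_distribution.

Section embedding.
Context {R : realType}.

Definition reflect_real (x : measurableTypeR R) : measurableTypeR R := - x.

Lemma measurable_reflect_real : measurable_fun setT reflect_real.
Proof. exact: measurable_realfun.oppr_measurable. Qed.

HB.instance Definition _ := isMeasurableFun.Build _ _ _ _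
  reflect_real measurable_reflect_real.

Definition sphere_of_real (x : measurableTypeR R) : borel (sphere R) :=
  Some (real_complex R x).

Lemma continuous_real_complex :
  continuous (fun x : R => real_complex R x : (R[i])^o).
Proof.
move=> x; apply/(@cvgrPdist_lt _ (R[i])^o) => e e0.
have eE : e = real_complex R (complex.Re e).
  by case: e e0 => u v; rewrite ltcE /= => /andP[/eqP -> _].
have e'0 : 0 < complex.Re e by rewrite -ltcR -eE.
near=> y; rewrite -rmorphB /= normc_def /= expr0n /= addr0 sqrtr_sqr eE ltcR.
near: y; exact: (@cvgr_dist_lt _ R^o).
Unshelve. all: by end_near. Qed.

Lemma measurable_sphere_of_real : measurable_fun setT sphere_of_real.
Proof.
apply: (@measurability _ _ _ (borel (sphere R)) setT _ (@open (sphere R)))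
  => // _ [U oU <-].
rewrite setTI; apply: measurable_realfun.open_measurable.
apply: (@open_comp R (sphere R) (fun x => Some (real_complex R x))) => // x _.
apply: (@continuous_comp R (R[i])^o (sphere R) (real_complex R) Some).
  exact: continuous_real_complex.
exact: one_point_compactification_some_continuous.
Qed.

HB.instance Definition _ := isMeasurableFun.Build _ _ _ _
  sphere_of_real measurable_sphere_of_real.

End embedding.

Section cauchy.
Context {R : realType}.

Definition reflection (mu : probability (measurableTypeR R) R) :
    probability (measurableTypeR R) R :=
  distribution mu reflect_real.

Definition on_sphere (mu : probability (measurableTypeR R) R) :
    probability (borel (sphere R)) R :=
  distribution mu sphere_of_real.

Definition cauchy_transform (mu : probability (measurableTypeR R) R) (t : R) : R :=
  (\int[mu]_z (t - z)^-1)%R.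

Definition has_density (mu : probability (measurableTypeR R) R) (p : R -> R) : Prop :=
  [/\ measurable_fun setT p, forall x, 0 <= p x &
  forall A : set (measurableTypeR R), measurable A ->
    mu A = (\int[lebesgue_measure]_(x in A) (p x)%:E)%E].

End cauchy.

Definition inverse_on (S T : Type) (A : set S) (B : set T)
    (f : S -> T) (g : T -> S) : Prop :=
  (forall x, A x -> B (f x) /\ g (f x) = x) /\
  (forall y, B y -> A (g y) /\ f (g y) = y).

Section arg.
Context {R : realType}.

(* The principal argument, in ]-pi, pi], with value 0 at 0; see ArgP. *)
Definition Arg (z : R[i]) : R :=
  if z == 0 then 0 else
  let theta := acos (complex.Re z / Normc.normc z) in
  if 0 <= complex.Im z then theta else - theta.

Lemma ArgP (z : R[i]) : z != 0 ->
  [/\ - pi < Arg z, Arg z <= pi,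
      complex.Re z = Normc.normc z * cos (Arg z) &
      complex.Im z = Normc.normc z * sin (Arg z)].
Proof.
case: z => u v z0; rewrite /Arg (negPf z0) /=.
set r := Num.sqrt _.
have r2 : r ^+ 2 = u ^+ 2 + v ^+ 2 by rewrite sqr_sqrtr// addr_ge0// sqr_ge0.
have r_gt0 : 0 < r.
  rewrite lt0r sqrtr_ge0 andbT; apply: contra z0 => /eqP r0.
  apply/eqP; apply: Normc.eq0_normc; exact: r0.
have rN0 : r != 0 by rewrite gt_eqF.
have ur : -1 <= u / r <= 1.
  by rewrite ler_pdivlMr// ler_pdivrMr//; apply/andP; split; nra.
have sr : sin (acos (u / r)) = `|v| / r.
  rewrite sin_acos// (_ : 1 - _ = (v / r) ^+ 2); last first.
    by rewrite !expr_div_n -[v ^+ 2](addKr (u ^+ 2)) -r2; field.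
  by rewrite sqrtr_sqr normrM normfV (gtr0_norm r_gt0).
have cr : cos (acos (u / r)) = u / r by apply: acosK; rewrite in_itv.
have := acos_ge0 ur; have := acos_lepi ur; have := pi_gt0 R.
set th := acos _ in sr cr *.
case: ifPn => v0 p0 th1 th2.
  by split; [lra| |rewrite cr; field|rewrite sr ger0_norm//; field].
rewrite -ltNge in v0.
split; [|lra|by rewrite cosN cr; field|by rewrite sinN sr ltr0_norm//; field].
rewrite ltrN2 lt_neqAle th1 andbT; apply/eqP => thpi.
move: sr; rewrite thpi sinpi => /esym/eqP.
by rewrite mulf_eq0 invr_eq0 (negPf rN0) orbF normr_eq0 lt_eqF.
Qed.

End arg.

Section limit_density.
Context {R : realType}.
Implicit Types a lambda x : R.

Definition t_plus a lambda : R :=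
  expR (- lambda) *
  (Num.sqrt (1 - a * expR (- lambda)) + Num.sqrt (a * (1 - expR (- lambda)))) ^+ 2.

Definition t_minus a lambda : R :=
  expR (- lambda) *
  (Num.sqrt (1 - a * expR (- lambda)) - Num.sqrt (a * (1 - expR (- lambda)))) ^+ 2.

(* The first two cases overlap at most at t_plus, a null set. *)
Definition limit_density a lambda x : R :=
  let tm := t_minus a lambda in let tp := t_plus a lambda in
  if (tp <= x <= 1) && (ln (1 + a) < lambda) then (lambda * x)^-1
  else if tm <= x <= tp then
    (lambda * pi * x)^-1 *
    Arg (Complex (a + 1 - expR lambda * x)
                 (expR lambda * Num.sqrt ((x - tm) * (tp - x))))
  else 0.

End limit_density.

(* Main.v *)
Require Import Defs.
From HB Require Import structures.
From mathcomp Require Import all_boot all_order all_algebra.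
From mathcomp Require Import complex.
From mathcomp Require Import all_classical all_reals all_analysis.
From mathcomp Require Import measurable_realfun ring lra.

Set Implicit Arguments.
Unset Strict Implicit.
Unset Printing Implicit Defensive.

Import Order.TTheory GRing.Theory Num.Theory.
Import numFieldNormedType.Exports.

Local Open Scope classical_set_scope.
Local Open Scope ring_scope.

(** Write q = e^(-lambda/n) and b = e^lambda = q^(-n).

    Zeros. The contiguous relation [little_qLaguerre_raise] between
    P_(n+1)(.; a) and P_n(.; aq), together with the intermediate value theorem,
    gives by induction on n that P_n(.; a) has n zeros z_0 > z_1 > ... in ]0, 1]
    with z_(i+1) <= q z_i ([zeros_little_qLaguerre]).

    Limit of the Cauchy transforms. For t > 0 the ratio r(t) = P_n(-qt)/P_n(-t)
    is the product of the (qt + z)/(t + z), and as 1 - q is of order lambda/n,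
    it is close to exp(-lambda S_n(t)), where S_n(t) is the mean of the
    t/(t + z) over the zeros z. The second-order q-difference equation
    [little_qLaguerre_qdiff] divided by P_n(-qt) relates r(t) and r(qt), which
    are asymptotically equal. Hence y = exp(-lambda S_n(t)) solves, up to O(1/n),
    the quadratic equation

        a y^2 - (1 + a + b t) y + (1 + t) = 0,

    which has exactly one root in ]1/b, 1[. So S_n(t) tends to
    -ln(y)/lambda ([cvg_sum_frac]), and solving the quadratic equation for t
    instead of y is the inverse function of the statement
    ([inverse_on_log_root]).

    Density. Let disc b x be the discriminant of the quadratic equation at
    t = -x. Differentiating the root in b gives
    d(-ln y)/db = t / sqrt(disc b (-t)), and this is the integral of t/(t + x)
    against (1/pi) dx / sqrt(- disc b x), an arcsine law of mass 1/b on the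
    interval where disc is negative. Since -ln y = 0 at b = 1, lambda times the limit
    measure is the integral of these laws over b in ]1, e^lambda[
    ([integral_arc_angle]). At a fixed x the integral over b of
    1/sqrt(- disc b x) is elementary and equals an arccosine divided by x; this
    is the argument in the formula of the density ([limit_density_arc_angle]).
    For a = 0 the arcsine laws degenerate to point masses, and the Cauchy
    transform is computed directly from the density.

    Weak convergence. All measures live on [0, 1] up to the reflection, so
    convergence of the integrals of 1/(1 + s x) for all s > 0 implies
    convergence of the integrals of all continuous functions
    ([stieltjes_continuity]). *)

(** * Weierstrass approximation *)
Section bernstein.
Context {R : realType}.
Implicit Types (h : nat -> R) (x : R).

(** The Bernstein operator of degree n, mapping h to the expectation of h(K) for
    K binomial with parameters n and 'X. Conditioning on the first trial gives
    this recursion, which spares all manipulations of binomial coefficients. *)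
Fixpoint bernstein (n : nat) (h : nat -> R) : {poly R} :=
  if n is m.+1 then
    (1 - 'X) * bernstein m h + 'X * bernstein m (fun k => h k.+1)
  else (h 0%N)%:P.

Lemma bernsteinS n h x : (bernstein n.+1 h).[x] =
  (1 - x) * (bernstein n h).[x] + x * (bernstein n (fun k => h k.+1)).[x].
Proof. by rewrite /= hornerE !hornerM hornerD hornerN hornerX hornerC. Qed.

Lemma bernstein_le n h1 h2 x : 0 <= x <= 1 ->
  (forall k, (k <= n)%N -> h1 k <= h2 k) ->
  (bernstein n h1).[x] <= (bernstein n h2).[x].
Proof.
move=> /andP[x0 x1]; elim: n h1 h2 => [|n IH] h1 h2 h12.
  by rewrite /= !hornerC h12.
rewrite !bernsteinS lerD// ler_wpM2l ?subr_ge0//.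
  by apply: IH => k kn; rewrite h12// leqW.
by apply: IH => k kn; rewrite h12.
Qed.

(** The bias-variance decomposition of the binomial law, for quadratic
    functions centred anywhere. *)
Lemma bernstein_quad n (u v c : R) x :
  (bernstein n (fun k => u + v * (k%:R - c) ^+ 2)).[x] =
  u + v * ((n%:R * x - c) ^+ 2 + n%:R * x * (1 - x)).
Proof.
elim: n c => [|n IH] c; first by rewrite /= hornerC !mul0r sub0r addr0.
rewrite bernsteinS IH.
have -> : (fun k => u + v * (k.+1%:R - c) ^+ 2) =
          (fun k => u + v * (k%:R - (c - 1)) ^+ 2).
  by apply/funext => k; rewrite -natr1; congr (_ + _ * _ ^+ 2); ring.
by rewrite IH -natr1; ring.
Qed.

Lemma bernsteinN n h x : (bernstein n (fun k => - h k)).[x] = - (bernstein n h).[x].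
Proof.
elim: n h => [|n IH] h; first by rewrite /= !hornerC.
by rewrite !bernsteinS !IH; ring.
Qed.

Lemma uniform_continuity01 (f : R -> R) : continuous f -> forall e, 0 < e ->
  exists2 d, 0 < d & forall x y, 0 <= x <= 1 -> `|x - y| < d -> `|f x - f y| <= e.
Proof.
move=> cf e e0.
have := (compact_near_coveringP _).1 (@segment_compact R 0 1).
move=> /(_ R 0^'+ (fun d x => forall y, `|x - y| < d -> `|f x - f y| <= e) _).
have h x : `[0, 1]%classic x -> \forall x' \near x & d \near 0^'+,
    forall y, `|x' - y| < d -> `|f x' - f y| <= e.
  move=> _; have e20 : 0 < e / 2 by lra.
  have /(@cvgrPdist_lt _ R^o)/(_ _ e20)/nbhs_ballP[d /= d0 dP] := cf x.
  exists (ball x (d / 2), [set u | 0 < u < d / 2]).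
    split => /=; first by apply: nbhsx_ballx; lra.
    near=> u; apply/andP; split => //; near: u; apply: nbhs_right_lt; lra.
  move=> [x' u] /= [xx' /andP[u0 ud]] y x'y.
  move: xx'; rewrite /ball /= => xx'.
  have h1 : `|f x - f x'| < e / 2 by apply: dP; rewrite /ball /=; lra.
  have h2 : `|f x - f y| < e / 2.
    apply: dP; rewrite /ball /=.
    by rewrite (le_lt_trans (ler_distD x' _ _))//; lra.
  rewrite (le_trans (ler_distD (f x) _ _))// (distrC (f x')); lra.
move=> /(_ h) H.
have [d [d0 dP]] : exists d : R, 0 < d /\ `[0, 1]%classic `<=`
    (fun x => forall y, `|x - y| < d -> `|f x - f y| <= e).
  near (0 : R)^'+ => d; exists d; split => //.
  exact: (near H d).
by exists d => // x y x01; apply: dP; rewrite /= in_itv.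
Unshelve. all: by end_near. Qed.

(** By uniform continuity and boundedness, |f x - f y| is at most
    e/2 + v (y - x)^2 for a suitable v, and the Bernstein operator sends the
    right-hand side, as a function of y = k/n, to e/2 + v x (1 - x)/n. *)
Lemma weierstrass01 (f : R -> R) : continuous f -> forall e, 0 < e ->
  exists p : {poly R}, forall x, 0 <= x <= 1 -> `|f x - p.[x]| <= e.
Proof.
move=> cf e e0.
have [M M0 fM] : exists2 M, 0 < M & forall x, 0 <= x <= 1 -> `|f x| <= M.
  have cn : {within `[0, 1], continuous (fun x => `|f x|)}.
    apply: continuous_subspaceT => x.
    exact: (continuous_comp (cf x) (@norm_continuous _ R^o (f x))).
  have [c _ cP] := EVT_max (@ler01 R) cn.
  exists (`|f c| + 1) => [|x x01]; first by have := normr_ge0 (f c); lra.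
  have : `|f x| <= `|f c| by apply: cP; rewrite in_itv.
  lra.
have [d d0 dP] := uniform_continuity01 cf (divr_gt0 e0 (ltr0Sn R 1)).
pose v := 2 * M / d ^+ 2.
have v0 : 0 < v by rewrite divr_gt0 ?exprn_gt0 ?mulr_gt0.
have key x y : 0 <= x <= 1 -> 0 <= y <= 1 ->
    `|f x - f y| <= e / 2 + v * (y - x) ^+ 2.
  move=> x01 y01; have [xy|xy] := ltP `|x - y| d.
    rewrite (le_trans (dP _ _ x01 xy))// lerDl mulr_ge0 ?sqr_ge0//; exact: ltW.
  have h : 1 <= (y - x) ^+ 2 / d ^+ 2.
    rewrite ler_pdivlMr ?exprn_gt0// mul1r -[(y - x) ^+ 2]real_normK ?num_real//.
    by rewrite distrC ler_sqr ?nnegrE// ltW.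
  have h2 : `|f x - f y| <= 2 * M.
    by rewrite (le_trans (ler_normB _ _))// mulr_natl lerD ?fM.
  have : 2 * M <= v * (y - x) ^+ 2.
    by rewrite /v -mulrA [_^-1 * _]mulrC ler_peMr// mulr_ge0 ?ltW.
  lra.
have [n nP] : exists n : nat, 2 * v / e < n%:R.
  exists (Num.bound (2 * v / e)); apply: archi_boundP.
  by apply/ltW/divr_gt0 => //; exact: mulr_gt0.
have n0 : (0 : R) < n%:R.
  by rewrite (lt_trans _ nP)// divr_gt0// mulr_gt0.
exists (bernstein n (fun k => f (k%:R / n%:R))) => x x01.
have kn01 k : (k <= n)%N -> 0 <= (k%:R / n%:R : R) <= 1.
  by move=> kn; rewrite divr_ge0//= ler_pdivrMr// mul1r ler_nat.
have quadE c : (c + (e / 2 + v * x * (1 - x) / n%:R)) = (bernstein n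
    (fun k => (c + e / 2) + (v / n%:R ^+ 2) * (k%:R - n%:R * x) ^+ 2)).[x].
  by rewrite bernstein_quad subrr; field; rewrite lt0r_neq0.
have small : v * x * (1 - x) / n%:R <= e / 2.
  rewrite ler_pdivrMr//; move: nP; rewrite ltr_pdivrMr// => nP.
  have : v * (x * (1 - x)) <= v * 1 by rewrite ler_wpM2l ?(ltW v0)//; move: x01; nra.
  lra.
have sq k : v / n%:R ^+ 2 * (k%:R - n%:R * x) ^+ 2 = v * (k%:R / n%:R - x) ^+ 2.
  by field; rewrite lt0r_neq0.
rewrite ler_distl; apply/andP; split.
  suff : (bernstein n (fun k => f (k%:R / n%:R))).[x] <=
      f x + (e / 2 + v * x * (1 - x) / n%:R) by lra.
  rewrite quadE; apply: bernstein_le => // k kn.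
  have := key x _ x01 (kn01 k kn); rewrite ler_distl sq; lra.
suff : - (bernstein n (fun k => f (k%:R / n%:R))).[x] <=
    - f x + (e / 2 + v * x * (1 - x) / n%:R) by lra.
rewrite quadE -bernsteinN; apply: bernstein_le => // k kn.
have := key x _ x01 (kn01 k kn); rewrite ler_distl sq; lra.
Unshelve. all: by end_near. Qed.

End bernstein.

(** * Convergence of Cauchy transforms implies weak convergence *)
Section stieltjes_continuity.
Context {R : realType}.
Implicit Types f g : R -> R.

Definition continuous01 f := {within `[0, 1], continuous f}.

(** The two properties of integration against a probability measure on [0, 1]
    that the argument uses; stated for functionals, so that averages over finite
    sequences and Lebesgue integrals are treated alike. *)
Definition mean_functional (L : (R -> R) -> R) : Prop :=
  (forall f g k, continuous01 f -> continuous01 g ->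
     L (fun x => f x + k * g x) = L f + k * L g) /\
  (forall f M, continuous01 f -> (forall x, 0 <= x <= 1 -> `|f x| <= M) ->
     `|L f| <= M).

Variables (Ln : nat -> (R -> R) -> R) (L : (R -> R) -> R).
Hypothesis LnP : \forall n \near \oo, mean_functional (Ln n).
Hypothesis LP : mean_functional L.

(* The set of such test functions is stable under linear combinations and
   uniform limits on [0, 1]. *)
Let converging f := continuous01 f /\ Ln n f @[n --> \oo] --> L f.

Lemma continuous01D f g k : continuous01 f -> continuous01 g ->
  continuous01 (fun x => f x + k * g x).
Proof.
move=> cf cg x; apply: (@cvgD _ R^o); first exact: cf.
by apply: cvgM; [exact: cvg_cst|exact: cg].
Qed.

Lemma cvg_functional_lin f g k : converging f -> converging g -> converging (fun x => f x + k * g x).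
Proof.
move=> [cf Lf] [cg Lg]; split; first exact: continuous01D.
rewrite LP.1//.
apply: (@cvg_trans _ ((fun n => Ln n f + k * Ln n g) @ \oo)); last first.
  by apply: cvgD => //; apply: cvgMr.
apply: near_eq_cvg; near=> n; rewrite (_ : mean_functional (Ln n)).1//.
by near: n.
Unshelve. all: by end_near. Qed.

Lemma cvg_functional_approx f : continuous01 f ->
  (forall e, 0 < e -> exists2 g, converging g &
    forall x, 0 <= x <= 1 -> `|f x - g x| <= e) -> converging f.
Proof.
move=> cf fg; split => //; apply/(@cvgrPdist_le _ R^o) => e e0.
have e30 : 0 < e / 3 by lra.
have [g [cg Lg] ge] := fg _ e30.
have cfg : continuous01 (fun x => f x + (-1) * g x) by exact: continuous01D.
have ge' x : 0 <= x <= 1 -> `|f x + -1 * g x| <= e / 3.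
  by move=> /ge; rewrite mulN1r.
near=> n.
have LnPn : mean_functional (Ln n) by near: n.
have h1 := LP.2 _ _ cfg ge'; have h2 := LnPn.2 _ _ cfg ge'.
have h3 : `|L g - Ln n g| <= e / 3.
  by near: n; apply: (@cvgr_dist_le _ R^o) => //.
rewrite LP.1// in h1; rewrite LnPn.1// in h2.
move: h1 h2 h3; rewrite !ler_norml; lra.
Unshelve. all: by end_near. Qed.

Hypothesis LnL : forall s, 0 < s ->
  Ln n (fun x => (1 + s * x)^-1) @[n --> \oo] --> L (fun x => (1 + s * x)^-1).

Lemma continuous01_frac k s : 0 < s ->
  continuous01 (fun x => x ^+ k / (1 + s * x)).
Proof.
move=> s0; apply: derivable_within_continuous => x; rewrite in_itv/= => /andP[x0 _].
have h : 1 + s * x != 0 by rewrite lt0r_neq0// ltr_wpDr// mulr_ge0// ltW.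
apply: derivableM; first exact: exprn_derivable.
by apply: derivableV => //; exact: ex_derive.
Qed.

Lemma continuous01X k : continuous01 (fun x => x ^+ k).
Proof. by apply: continuous_subspaceT => x; exact: exprn_continuous. Qed.

(** On [0, 1], x^k is the uniform limit of x^k / (1 + s x) as s -> 0, and
    x^(k+1) / (1 + s x) = (x^k - x^k / (1 + s x)) / s. Starting from
    1 / (1 + s x), these two facts reach all powers by induction. *)
Lemma cvg_functional_powers k : (forall s, 0 < s -> converging (fun x => x ^+ k / (1 + s * x))) /\
  converging (fun x => x ^+ k).
Proof.
have powers j : (forall s, 0 < s -> converging (fun x => x ^+ j / (1 + s * x))) ->
    converging (fun x => x ^+ j).
  move=> H; apply: cvg_functional_approx; first exact: continuous01X.
  move=> e e0; exists (fun x => x ^+ j / (1 + e * x)); first exact: H.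
  move=> x /andP[x0 x1]; have h : 0 < 1 + e * x by have := mulr_ge0 (ltW e0) x0; lra.
  have -> : x ^+ j - x ^+ j / (1 + e * x) = e * (x ^+ j.+1 / (1 + e * x)).
    by rewrite exprS; field; rewrite lt0r_neq0.
  have xj : 0 <= x ^+ j.+1 <= 1 by rewrite exprn_ge0// exprn_ile1.
  have xj0 : 0 <= x ^+ j.+1 / (1 + e * x).
    by apply: divr_ge0; [case/andP: xj|exact: ltW].
  rewrite ger0_norm; last by apply: mulr_ge0 => //; exact: ltW.
  rewrite ler_piMr ?(ltW e0)// ler_pdivrMr// mul1r.
  by have := mulr_ge0 (ltW e0) x0; lra.
elim: k => [|k [IH1 IH2]].
  have H : forall s, 0 < s -> converging (fun x => x ^+ 0 / (1 + s * x)).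
    move=> s s0; split; first exact: continuous01_frac.
    have -> : (fun x => x ^+ 0 / (1 + s * x)) = (fun x => (1 + s * x)^-1).
      by apply/funext => x; rewrite expr0 mul1r.
    exact: LnL.
  by split; [exact: H|exact: powers].
have H : forall s, 0 < s -> converging (fun x => x ^+ k.+1 / (1 + s * x)).
  move=> s s0.
  have g1 := cvg_functional_lin (-1) IH2 (IH1 s s0).
  (* g2 is g1 / s; it agrees with x^(k+1) / (1 + s x) only where 1 + s x <> 0 *)
  have g2 := cvg_functional_lin (s^-1 - 1) g1 g1.
  apply: cvg_functional_approx; first exact: continuous01_frac.
  move=> e e0; eexists; first exact: g2.
  move=> x /andP[x0 x1]; have h : 0 < 1 + s * x by have := mulr_ge0 (ltW s0) x0; lra.
  rewrite [X in `|X|](_ : _ = 0) ?normr0 ?(ltW e0)//.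
  by rewrite exprS; field; rewrite !lt0r_neq0.
by split; [exact: H|exact: powers].
Qed.

Lemma cvg_functional_poly (p : {poly R}) : converging (horner p).
Proof.
rewrite (_ : horner p = fun x => \sum_(i < size p) p`_i * x ^+ i); last first.
  by apply/funext => x; rewrite horner_coef.
elim: (size p) => [|n IH].
  have g0 := cvg_functional_lin (-1) (cvg_functional_powers 0).2 (cvg_functional_powers 0).2.
  rewrite (_ : (fun x => _) = (fun x : R => x ^+ 0 + -1 * x ^+ 0))//.
  by apply/funext => x; rewrite big_ord0 expr0 mulr1 subrr.
have := cvg_functional_lin p`_n IH (cvg_functional_powers n).2.
by congr converging; apply/funext => x; rewrite big_ord_recr.
Qed.

Theorem stieltjes_continuity f : continuous f -> Ln n f @[n --> \oo] --> L f.
Proof.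
move=> cf; suff : converging f by case.
apply: cvg_functional_approx; first exact: continuous_subspaceT.
move=> e e0; have [p pe] := weierstrass01 cf e0.
by exists (horner p) => //; exact: cvg_functional_poly.
Qed.

End stieltjes_continuity.

(** * Little q-Laguerre polynomials: recurrences *)
Section little_q_Laguerre_algebra.
Context {R : realType}.
Implicit Types a q t x : R.

(** The coefficients of P_n(-x; a|q), which are positive up to degree n. The
    product vanishes for k > n, which makes the sums below telescope. *)
Definition qL_coef (n : nat) a q (k : nat) : R :=
  \prod_(l < k) ((q ^+ l.+1 / q ^+ n - q) / ((1 - a * q ^+ l.+1) * (1 - q ^+ l.+1))).

Lemma qL_coefS n a q k : qL_coef n a q k.+1 = qL_coef n a q k *
  ((q ^+ k.+1 / q ^+ n - q) / ((1 - a * q ^+ k.+1) * (1 - q ^+ k.+1))).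
Proof. by rewrite /qL_coef big_ord_recr. Qed.

Lemma phi21_qL_coef n a q k : q != 0 ->
  phi21_coef (q ^- n) 0 (a * q) q k * q ^+ k = (-1) ^+ k * qL_coef n a q k.
Proof.
move=> q0; elim: k => [|k IH].
  by rewrite /phi21_coef /qpochhammer /qL_coef !big_ord0 !expr0 !mulr1 divr1.
rewrite qL_coefS !exprSr [RHS]mulrACA -IH.
rewrite /phi21_coef /qpochhammer !big_ord_recr /= mul0r subr0 mulr1 !invfM.
rewrite -!exprSr !exprS.
set A := \prod_(i < k) _; set B := \prod_(i < k) _; set C := (\prod_(i < k) _)^-1.
set D := (\prod_(i < k) _)^-1; rewrite !mulrA.
set E := (1 - a * q * _)^-1; set F := (1 - _ * _)^-1.
by ring.
Qed.

Lemma little_qLaguerre_poly n a q : q != 0 ->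
  little_qLaguerre n a q = \poly_(k < n.+1) ((-1) ^+ k * qL_coef n a q k).
Proof.
move=> q0; rewrite /little_qLaguerre poly_def; apply: eq_bigr => k _.
by rewrite exprZn scalerA phi21_qL_coef.
Qed.

Lemma little_qLaguerre_opp n a q t : q != 0 ->
  (little_qLaguerre n a q).[- t] = \sum_(k < n.+1) qL_coef n a q k * t ^+ k.
Proof.
move=> q0; rewrite little_qLaguerre_poly// horner_poly; apply: eq_bigr => k _.
by rewrite [(- t) ^+ _]exprNn mulrACA -signr_odd -expr2 sqrr_sign mul1r.
Qed.

Lemma little_qLaguerre_explicit n a q x : 0 < q < 1 ->
  (little_qLaguerre n a q).[- x] =
    \sum_(0 <= k < n.+1)
      (\prod_(1 <= l < k.+1)
         ((q ^ (l%:Z - n%:Z) - q) / ((1 - a * q ^+ l) * (1 - q ^+ l)))) * x ^+ k.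
Proof.
move=> /andP[q0 _]; have qN0 : q != 0 by rewrite lt0r_neq0.
rewrite little_qLaguerre_opp// big_mkord; apply: eq_bigr => k _; congr (_ * _).
rewrite big_add1 /= big_mkord; apply: eq_bigr => l _.
by rewrite expfzDr// exprnN.
Qed.

Variable q : R.
Hypothesis q01 : 0 < q < 1.

Let q0 : 0 < q. Proof. by case/andP: q01. Qed.
Let q1 : q < 1. Proof. by case/andP: q01. Qed.
Let qN0 : q != 0. Proof. by rewrite lt0r_neq0. Qed.

Lemma subr1_exprS_gt0 k : 0 < 1 - q ^+ k.+1.
Proof. by rewrite subr_gt0 exprn_ilt1// ltW. Qed.

Lemma subr1_mul_exprS_gt0 a k : 0 <= a <= 1 -> 0 < 1 - a * q ^+ k.+1.
Proof.
move=> /andP[a0 a1]; have := subr1_exprS_gt0 k; rewrite !subr_gt0 => h.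
by rewrite (le_lt_trans _ h)// ler_piMl// exprn_ge0// ltW.
Qed.

Lemma qL_coef_gt0 n a k : 0 <= a <= 1 -> (k <= n)%N -> 0 < qL_coef n a q k.
Proof.
move=> a01 kn; apply: prodr_gt0 => l _.
rewrite divr_gt0 ?mulr_gt0 ?subr1_exprS_gt0 ?subr1_mul_exprS_gt0//.
rewrite subr_gt0 ltr_pdivlMr ?exprn_gt0// -exprS.
by rewrite ltr_iXn2l// ltnS (leq_trans (ltn_ord l)).
Qed.

Lemma qL_coef_eq0 n a : qL_coef n a q n.+1 = 0.
Proof. by rewrite qL_coefS exprS mulfK ?expf_neq0// subrr mul0r mulr0. Qed.

Lemma little_qLaguerre0 n a : (little_qLaguerre n a q).[0] = 1.
Proof.
rewrite -oppr0 little_qLaguerre_opp// big_ord_recl big1 ?addr0.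
  by rewrite /qL_coef big_ord0 expr0 mulr1.
by move=> i _; rewrite expr0n mulr0.
Qed.

Lemma size_little_qLaguerre n a : 0 <= a <= 1 -> size (little_qLaguerre n a q) = n.+1.
Proof.
move=> a01; rewrite little_qLaguerre_poly// size_poly_eq//.
by rewrite mulf_neq0 ?signr_eq0 ?lt0r_neq0 ?qL_coef_gt0.
Qed.

(** Multiplication of the k-th coefficient by (1 - q^k)(1 - a q^k) is, on one
    side, a combination of the dilations of y and, on the other side, given by
    the coefficient of index k - 1; the difference of the two is a telescoping
    sum. *)
Lemma little_qLaguerre_qdiff n a t : 0 <= a <= 1 ->
  let y x := (little_qLaguerre n a q).[- x] in
  (1 + q * t) * y t - (1 + a + q * (q ^+ n)^-1 * t) * y (q * t) +
    a * y (q * (q * t)) = 0.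
Proof.
move=> a01 y; rewrite /y !little_qLaguerre_opp// !mulr_sumr.
rewrite -sumrB -big_split /=.
pose u k := qL_coef n a q k * t ^+ k * ((1 - q ^+ k) * (1 - a * q ^+ k)).
transitivity (\sum_(k < n.+1) (- (u k.+1 - u k))).
  apply: eq_bigr => k _; rewrite /u qL_coefS !exprMn opprB.
  have := subr1_exprS_gt0 k; have := subr1_mul_exprS_gt0 k a01.
  rewrite !exprS => /lt0r_neq0 h1 /lt0r_neq0 h2.
  by field; rewrite expf_neq0// h1 h2.
rewrite sumrN -(big_mkord xpredT (fun k => u k.+1 - u k)) telescope_sumr//.
by rewrite /u qL_coef_eq0 !mul0r expr0 subrr mul0r mulr0 subrr oppr0.
Qed.

Lemma mulq01 a : 0 <= a <= 1 -> 0 <= a * q <= 1.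
Proof.
by move=> /andP[a0 a1]; rewrite mulr_ge0 ?(ltW q0)//= mulr_ile1 ?(ltW q0) ?(ltW q1).
Qed.

Lemma qL_coef_raise n a k : 0 <= a <= 1 ->
  qL_coef n.+1 a q k.+1 * (1 - a * q) * (1 - q ^+ k.+1) =
  qL_coef n (a * q) q k * ((q ^+ n)^-1 - q).
Proof.
move=> a01; have qn0 : q ^+ n != 0 by rewrite expf_neq0.
have aq01 := mulq01 a01.
elim: k => [|k IH].
  have h1 := lt0r_neq0 (subr1_mul_exprS_gt0 0 a01).
  have h2 := lt0r_neq0 (subr1_exprS_gt0 0).
  rewrite /qL_coef big_ord_recl !big_ord0 !expr1 in h1 h2 *.
  rewrite exprS; field.
  by rewrite qn0 h1 h2 qN0.
rewrite qL_coefS [in RHS]qL_coefS.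
have h1 := lt0r_neq0 (subr1_mul_exprS_gt0 k aq01).
have h2 := lt0r_neq0 (subr1_exprS_gt0 k).
have h3 := lt0r_neq0 (subr1_mul_exprS_gt0 k.+1 a01).
have h4 := lt0r_neq0 (subr1_exprS_gt0 k.+1).
have -> : qL_coef n (a * q) q k * ((q ^+ k.+1 / q ^+ n - q) /
    ((1 - a * q * q ^+ k.+1) * (1 - q ^+ k.+1))) * ((q ^+ n)^-1 - q) =
    qL_coef n (a * q) q k * ((q ^+ n)^-1 - q) * ((q ^+ k.+1 / q ^+ n - q) /
    ((1 - a * q * q ^+ k.+1) * (1 - q ^+ k.+1))) by ring.
rewrite -IH.
have e : a * q * q ^+ k.+1 = a * q ^+ k.+2 by rewrite -mulrA -exprS.
rewrite e in h1 *.
have -> : q ^+ k.+2 / q ^+ n.+1 - q = q ^+ k.+1 / q ^+ n - q.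
  by rewrite !exprS; field; rewrite qN0 qn0.
by field; rewrite qn0 h1 h2 h4.
Qed.

(** The backward shift relation, which raises the degree and replaces aq by a.
    The coefficients of index k + 1 agree because of [qL_coef_raise] and the
    recurrence for the coefficients of P_n(.; aq). *)
Lemma little_qLaguerre_raise n a t : 0 <= a <= 1 ->
  (1 - a * q) * (little_qLaguerre n.+1 a q).[- (q * t)] =
  (1 + q * t) * (little_qLaguerre n (a * q) q).[- t] -
    a * q * (little_qLaguerre n (a * q) q).[- (q * t)].
Proof.
move=> a01; have qn0 : q ^+ n != 0 by rewrite expf_neq0.
rewrite !little_qLaguerre_opp// !mulr_sumr.
rewrite big_ord_recl /= {1}/qL_coef big_ord0 expr0 !mulr1.
pose v k := qL_coef n (a * q) q k * (1 - a * q ^+ k.+1) * t ^+ k.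
transitivity (v 0%N + \sum_(k < n.+1) (v k.+1 + q * t * qL_coef n (a * q) q k * t ^+ k)).
  congr (_ + _); first by rewrite /v /qL_coef big_ord0 mul1r expr0 mulr1 expr1.
  apply: eq_bigr => k _; rewrite /bump /= add1n.
  have h2 := lt0r_neq0 (subr1_exprS_gt0 k).
  have -> : qL_coef n.+1 a q k.+1 = qL_coef n (a * q) q k * ((q ^+ n)^-1 - q) /
      ((1 - a * q) * (1 - q ^+ k.+1)).
    rewrite -qL_coef_raise//; field; rewrite h2 /=.
    by have := lt0r_neq0 (subr1_mul_exprS_gt0 0 a01); rewrite expr1 => ->.
  rewrite /v qL_coefS.
  have h3 := lt0r_neq0 (subr1_mul_exprS_gt0 k.+1 a01).
  have e : a * q * q ^+ k.+1 = a * q ^+ k.+2 by rewrite -mulrA -exprS.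
  rewrite e exprMn.
  have h1 := lt0r_neq0 (subr1_mul_exprS_gt0 0 a01); rewrite expr1 in h1.
  have -> : q ^+ k.+2 = q * q ^+ k.+1 by rewrite exprS.
  rewrite [q ^+ k.+2]exprS in h3.
  move: h2 h3; rewrite [t ^+ k.+1]exprS.
  move: (q ^+ k.+1) => Q h2 h3.
  by field; rewrite h1 h2 h3 qn0.
rewrite big_split /= addrA.
have -> : v 0%N + \sum_(i < n.+1) v i.+1 = \sum_(k < n.+1) v k.
  have <- : \sum_(k < n.+2) v k = \sum_(k < n.+1) v k.
    by rewrite big_ord_recr /= {2}/v qL_coef_eq0 !mul0r addr0.
  by rewrite [RHS]big_ord_recl; congr (_ + _); apply: eq_bigr => i _.
rewrite -big_split -sumrB /=; apply: eq_bigr => k _.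
by rewrite /v exprMn exprS; ring.
Qed.

End little_q_Laguerre_algebra.

(** * Zeros of the little q-Laguerre polynomials *)
Section zeros_of_little_q_Laguerre.
Context {R : realType}.
Variable q : R.
Hypothesis q01 : 0 < q < 1.
Implicit Types a x : R.

Let q0 : 0 < q. Proof. by case/andP: q01. Qed.
Let q1 : q < 1. Proof. by case/andP: q01. Qed.
Let qN0 : q != 0. Proof. by rewrite lt0r_neq0. Qed.

(** The sequence s, when extended by q^(-1) on the left and by zeros on the
    right, shrinks by a factor of at most q at each step. The first inequality
    says that the first element is at most 1, and the last one that the last
    element is nonnegative; with these conventions the induction step below
    treats the extreme zeros like the others. *)
Definition geometric_decay (s : seq R) : Prop :=
  forall i, nth 0 (q^-1 :: s) i.+1 <= q * nth 0 (q^-1 :: s) i.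

Lemma decay_ge0 (s : seq R) : all (fun z => 0 < z) s ->
  forall i, 0 <= nth 0 (q^-1 :: s) i.
Proof.
move=> s0 [|i] /=; first by rewrite invr_ge0 ltW.
have [h|h] := ltnP i (size s); last by rewrite nth_default.
by apply: ltW; move/all_nthP : s0; exact.
Qed.

Lemma decay_le (s : seq R) : all (fun z => 0 < z) s -> geometric_decay s ->
  forall i j, (i <= j)%N -> nth 0 (q^-1 :: s) j <= nth 0 (q^-1 :: s) i.
Proof.
move=> s0 sd i j ij; have Z0 := decay_ge0 s0.
elim: j ij => [|j IH]; first by rewrite leqn0 => /eqP ->.
rewrite leq_eqVlt => /predU1P[->//|]; rewrite ltnS => /IH.
by apply: le_trans; rewrite (le_trans (sd j))// ler_piMl// ltW.
Qed.

Lemma decay_le1 (s : seq R) : all (fun z => 0 < z) s -> geometric_decay s ->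
  all (fun z => 0 < z <= 1) s.
Proof.
move=> s0 sd; apply/(all_nthP 0) => i h; apply/andP; split.
  by move/all_nthP : s0; exact.
have := decay_le s0 sd (ltn0Sn i : (1 <= i.+1)%N).
by move=> /le_trans; apply; rewrite (le_trans (sd 0%N))//= mulfV.
Qed.

Lemma decay_uniq (s : seq R) : all (fun z => 0 < z) s -> geometric_decay s -> uniq s.
Proof.
move=> s0 sd; apply/(uniqP 0) => i j; rewrite !inE.
wlog : i j / (i < j)%N => [H|ij] hi hj e.
  have [ij|ji|//] := ltngtP i j; first exact: H.
  by apply/esym; exact: H.
have zi : 0 < nth 0 s i by move/all_nthP : s0; exact.
have h := decay_le s0 sd (ij : (i.+2 <= j.+1)%N).
have := le_trans h (sd i.+1); rewrite /= -e => h'.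
by have : q * nth 0 s i < nth 0 s i by [rewrite gtr_pMl]; rewrite ltNge h'.
Qed.

(** A polynomial with zeros s does not change sign between two consecutive
    zeros: each factor has the same sign at u and at v. *)
Lemma decay_sign (s : seq R) (c : R) i u v :
  all (fun z => 0 < z) s -> geometric_decay s ->
  let Z := nth 0 (q^-1 :: s) in
  Z i.+1 <= u <= Z i -> Z i.+1 <= v <= Z i ->
  0 <= (c *: \prod_(z <- s) ('X - z%:P)).[u] * (c *: \prod_(z <- s) ('X - z%:P)).[v].
Proof.
move=> s0 sd Z /andP[u1 u2] /andP[v1 v2].
rewrite !hornerZ mulrACA -expr2 mulr_ge0 ?sqr_ge0//.
rewrite !horner_prod -big_split /=; rewrite big_seq; apply: prodr_ge0 => z.
move=> /(nthP 0)[j js <-]; rewrite !hornerXsubC.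
have [ij|ji] := leqP i j.
  have h := decay_le s0 sd (ij : (i.+1 <= j.+1)%N).
  by rewrite mulr_ge0 ?subr_ge0// (le_trans h).
have h := decay_le s0 sd (ji : (j.+1 <= i)%N).
by rewrite mulr_le0 ?subr_le0// (le_trans _ h).
Qed.

Lemma root_between (p : {poly R}) u v : u <= v -> p.[u] * p.[v] <= 0 ->
  exists2 x, u <= x <= v & root p x.
Proof.
move=> uv puv.
have cp : {within `[u, v], continuous (horner p)}.
  by apply: continuous_subspaceT => x; exact: continuous_horner.
have h : Num.min p.[u] p.[v] <= 0 <= Num.max p.[u] p.[v].
  rewrite ge_min le_max; have [h1|h1] := ltP 0 p.[u].
    by move: puv; rewrite pmulr_rle0// => ->; rewrite (ltW h1) orbT.
  have [h2|h2] := ltP p.[v] 0; last by rewrite orbT ?h1.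
  by move: puv; rewrite nmulr_lle0// => ->; rewrite ?h1.
have [x xI px] := IVT uv cp h.
by exists x; [move: xI; rewrite in_itv|apply/eqP].
Qed.

(** Let w = P_n(.; aq) have the zeros z_i, extended to Z by 1/q and 0 as above.
    By the backward shift relation f = P_(n+1)(.; a) is a positive multiple of
    (1 - x) w(x/q) - aq w(x). At x = q Z_i the first term vanishes, at
    x = Z_(i+1) the second one does (for i < n), and the remaining values of w
    are taken between Z_(i+1) and Z_i, where w has constant sign. So f has a zero
    in [Z_(i+1), q Z_i] for each i <= n, and these zeros again decay by the
    factor q. *)
Theorem zeros_little_qLaguerre n a : 0 <= a <= 1 ->
  exists s : seq R, [/\ size s = n, all (fun z => 0 < z) s, geometric_decay s &
    little_qLaguerre n a q =
      lead_coef (little_qLaguerre n a q) *: \prod_(z <- s) ('X - z%:P)].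
Proof.
elim: n a => [|n IH] a a01.
  exists [::]; split => //; first by move=> [|[|i]] /=; rewrite ?mulfV ?mulr0.
  apply: all_roots_prod_XsubC => //; exact: size_little_qLaguerre.
have [s [sn s0 sd wE]] := IH _ (mulq01 q01 a01).
set w := little_qLaguerre n (a * q) q in wE.
set c := lead_coef w in wE.
set f := little_qLaguerre n.+1 a q.
pose Z := nth 0 (q^-1 :: s).
have Z0 i : 0 <= Z i by exact: decay_ge0.
have aq1 : 0 < 1 - a * q by have := subr1_mul_exprS_gt0 q01 0 a01; rewrite expr1.
have [a0 a1] : 0 <= a /\ a <= 1 by case/andP: a01.
have aq0 : 0 <= a * q by rewrite mulr_ge0// ltW.
have fE x : (1 - a * q) * f.[x] = (1 - x) * w.[q^-1 * x] - a * q * w.[x].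
  have := little_qLaguerre_raise q01 n (- (q^-1 * x)) a01.
  by rewrite !mulrN !opprK mulrA mulfV// mul1r.
have wZ i : (i < n)%N -> w.[Z i.+1] = 0.
  move=> i_n; apply/eqP; rewrite wE -/(root _ _) rootZ; last first.
    by rewrite lead_coef_eq0 -size_poly_eq0 size_little_qLaguerre ?mulq01.
  by rewrite root_prod_XsubC /Z /= mem_nth ?sn.
have sgn i u v : Z i.+1 <= u <= Z i -> Z i.+1 <= v <= Z i -> 0 <= w.[u] * w.[v].
  by rewrite wE; exact: decay_sign.
have qZ i : q * Z i <= Z i by rewrite ler_piMl// ltW.
have rts i : exists r, (i <= n)%N -> [/\ Z i.+1 <= r, r <= q * Z i & root f r].
  have [i_n|_] := leqP i n; last by exists 0.
  have fv : (1 - a * q) * f.[q * Z i] = - (a * q * w.[q * Z i]).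
    rewrite fE mulKf//; case: i i_n => [_|i i_n].
      by rewrite /Z /= mulfV// subrr mul0r sub0r.
    by rewrite wZ// mulr0 sub0r.
  have vI : Z i.+1 <= q * Z i <= Z i by rewrite sd qZ.
  have uI : Z i.+1 <= q^-1 * Z i.+1 <= Z i.
    rewrite [q^-1 * _]mulrC ler_pdivlMr// ler_pdivrMr// [Z i * q]mulrC sd andbT.
    by rewrite mulrC qZ.
  have prod : f.[Z i.+1] * f.[q * Z i] <= 0.
    rewrite -(pmulr_rle0 _ (mulr_gt0 aq1 aq1)) mulrACA fv fE.
    (* for i = n the left end is 0, where f = w = 1 *)
    move: i_n; rewrite leq_eqVlt => /predU1P[iE|i_n].
      have Zi0 : Z i.+1 = 0 by rewrite iE /Z nth_default//= sn.
      have wv : 0 <= w.[Z i.+1] * w.[q * Z i].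
        by apply: (sgn i) => //; rewrite lexx (le_trans (sd i)).
      rewrite Zi0 little_qLaguerre0// mul1r in wv.
      rewrite Zi0 mulr0 little_qLaguerre0// subr0 !mulr1.
      by rewrite mulrN oppr_le0 !mulr_ge0// ltW.
    rewrite wZ// mulr0 subr0 mulrN oppr_le0.
    have -> : (1 - Z i.+1) * w.[q^-1 * Z i.+1] * (a * q * w.[q * Z i]) =
        (1 - Z i.+1) * (a * q) * (w.[q^-1 * Z i.+1] * w.[q * Z i]) by ring.
    rewrite mulr_ge0 ?(sgn i)// mulr_ge0// subr_ge0.
    have /(all_nthP 0) := decay_le1 s0 sd.
    by move=> /(_ i); rewrite sn => /(_ i_n) /andP[].
  have [r /andP[r1 r2] fr] := root_between (sd i) prod.
  by exists r.
have [r rP] := choice rts.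
pose s' := mkseq r n.+1.
have r0 i : (i <= n)%N -> 0 < r i.
  move=> i_n; have [r1 r2 fr] := rP i i_n.
  rewrite lt0r (le_trans (Z0 _) r1) andbT; apply: contraL fr => /eqP ->.
  by rewrite /root little_qLaguerre0// oner_eq0.
have s'0 : all (fun z => 0 < z) s'.
  by apply/(all_nthP 0) => i; rewrite size_mkseq => i_n; rewrite nth_mkseq// r0.
have s'd : geometric_decay s'.
  move=> i /=; have [i_n|i_n] := leqP i n; last first.
    rewrite nth_default ?size_mkseq// mulr_ge0//; [exact: ltW|exact: decay_ge0].
  rewrite nth_mkseq//; have [_ r2 _] := rP i i_n.
  case: i i_n r2 => [_ /= r2|i i_n r2] /=; first exact: r2.
  rewrite nth_mkseq; last exact: ltnW.
  have [r1' _ _] := rP i (ltnW i_n).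
  by rewrite (le_trans r2)// ler_wpM2l// ltW.
exists s'; split => //; first by rewrite size_mkseq.
apply: all_roots_prod_XsubC.
- by rewrite size_mkseq size_little_qLaguerre.
- apply/(all_nthP 0) => i; rewrite size_mkseq => i_n; rewrite nth_mkseq//.
  by have [] := rP i i_n.
- by rewrite uniq_rootsE; exact: decay_uniq.
Qed.

End zeros_of_little_q_Laguerre.

(** * Integrals of derivatives with singular end points *)
Section improper_integrals.
Context {R : realType}.
Notation mu := (@lebesgue_measure R).

(** The integrand may be unbounded at the end points: the fundamental theorem
    on [c + e_n, d - e_n] and monotone convergence. *)
Lemma ge0_FTC2_oo (f F : R -> R) (c d : R) : c < d ->
  {within `[c, d], continuous F} ->
  {in `]c, d[, continuous f} ->
  (forall x, x \in `]c, d[ -> is_derive x 1 F (f x)) ->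
  (forall x, x \in `]c, d[ -> 0 <= f x) ->
  (\int[mu]_(x in `]c, d[) (f x)%:E = (F d - F c)%:E)%E.
Proof.
move=> cd /(continuous_within_itvP _ cd)[_ Fc Fd] cf dF f0.
pose e n : R := (d - c) / 3 * harmonic n.
have e0 n : 0 < e n by rewrite mulr_gt0 ?divr_gt0 ?subr_gt0// invr_gt0 ltr0n.
have ecd n : c + e n < d - e n.
  have : e n <= (d - c) / 3.
    by rewrite ler_piMr ?invf_le1 ?ler1n ?ltr0n// divr_ge0// ?subr_ge0 ltW.
  have : 0 < d - c by rewrite subr_gt0.
  lra.
have e_cvg : e n @[n --> \oo] --> 0.
  by rewrite -[0](mulr0 ((d - c) / 3)); apply: cvgMr; exact: cvg_harmonic.
have e_dec m n : (m <= n)%N -> e n <= e m.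
  move=> mn; rewrite ler_wpM2l ?divr_ge0 ?subr_ge0 ?(ltW cd)//.
  by rewrite /harmonic /= lef_pV2 ?posrE ?ltr0n// ler_nat.

pose I n := `[c + e n, d - e n]%classic.
have II : \bigcup_n I n = `]c, d[%classic.
  apply/seteqP; split => [x [n _]|x]; rewrite /I /= !in_itv/=.
    by move=> /andP[? ?]; have := e0 n; lra.
  move=> /andP[cx xd].
  have [n _ /(_ n (leqnn n)) xn] : \forall n \near \oo, e n < Num.min (x - c) (d - x).
    by apply: (cvgr_lt 0 e_cvg); rewrite lt_min !subr_gt0 cx.
  by exists n => //; rewrite /I /= in_itv/=; move: xn; rewrite lt_min => /andP[? ?]; lra.
have In n : (\int[mu]_(x in I n) (f x)%:E = (F (d - e n) - F (c + e n))%:E)%E.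
  have sub x : x \in `[c + e n, d - e n] -> x \in `]c, d[.
    by rewrite !in_itv/=; have := e0 n; lra.
  have cF x : x \in `]c, d[ -> {for x, continuous F}.
    move=> /dF [dFx _]; exact/differentiable_continuous/derivable1_diffP.
  rewrite EFinB; apply: continuous_FTC2 => //.
  - apply: continuous_in_subspaceT => x /set_mem /= /sub; exact: cf.
  - split.
    + by move=> x xI; have [] := dF x (sub x (subset_itv_oo_cc xI)).
    + apply: cvg_at_right_filter; apply: cF; rewrite in_itv/=.
      by have := e0 n; have := ecd n; lra.
    + apply: cvg_at_left_filter; apply: cF; rewrite in_itv/=.
      by have := e0 n; have := ecd n; lra.
  - move=> x xI; rewrite derive1E.
    by have [_] := dF x (sub x (subset_itv_oo_cc xI)).
have mf : measurable_fun `]c, d[ (EFin \o f).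
  apply/measurable_EFinP; apply: open_continuous_measurable_fun => //.
  by move=> x /set_mem; exact: cf.
have IS n : I n `<=` `]c, d[ by rewrite -II; exact: bigcup_sup.
have h1 : (\int[mu]_(x in I n) (f x)%:E)%E @[n --> \oo] -->
    (\int[mu]_(x in \bigcup_n I n) (f x)%:E)%E.
  apply: ge0_nondecreasing_set_cvg_integral.
  - apply/nondecreasing_seqP => n; rewrite subsetEset => x; rewrite /I /= !in_itv/=.
    by have := e_dec _ _ (leqnSn n); lra.
  - by move=> n; exact: measurable_itv.
  - by move=> n; exact: measurable_funS (IS n) mf.
  - by move=> n x /IS xI; rewrite lee_fin f0.
have h2 : (\int[mu]_(x in I n) (f x)%:E)%E @[n --> \oo] --> (F d - F c)%:E.
  under eq_cvg do rewrite In.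
  apply/cvg_EFin; first by near=> n.
  apply: cvgB.
  - move/cvg_at_leftP : Fd; apply; split => [n|]; first by rewrite ltrBlDr ltrDl.
    by rewrite -[X in _ --> X]subr0; apply: cvgB => //; exact: cvg_cst.
  - move/cvg_at_rightP : Fc; apply; split => [n|]; first by rewrite ltrDl.
    by rewrite -[X in _ --> X]addr0; apply: cvgD => //; exact: cvg_cst.
by rewrite -II; exact: (cvg_unique (@ereal_hausdorff R) h1 h2).
Unshelve. all: by end_near. Qed.

Lemma within_continuous_acos : {within `[-1, 1], continuous (@acos R)}.
Proof.
have := @segment_can_ge_continuous R 0 pi cos acos.
rewrite cospi cos0; apply; first exact: pi_ge0.
  by apply: continuous_subspaceT => x; exact: continuous_cos.
exact: cosK.
Qed.

Lemma measurable_inv : measurable_fun [set: R] (@GRing.inv R).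
Proof.
have -> : [set: R] = [set 0] `|` [set~ 0] by rewrite setUv.
apply/measurable_funU => //; first exact: measurableC.
split; first exact: measurable_fun_set1.
apply: open_continuous_measurable_fun; first exact/closed_openC/closed_eq.
by move=> x; rewrite inE /= => /eqP x0; exact: inv_continuous.
Qed.

End improper_integrals.

Section arccosine_primitive.
Context {R : realType}.
Notation mu := (@lebesgue_measure R).

Lemma cvg_acos (T : Type) (F : set_system T) (FF : Filter F) (v : T -> R) (l : R) :
  -1 <= l <= 1 -> (\forall x \near F, -1 <= v x <= 1) ->
  v x @[x --> F] --> l -> acos (v x) @[x --> F] --> acos l.
Proof.
move=> l1 v1 vl U /= Ul.
have /subspace_continuousP/(_ l) := @within_continuous_acos R.
rewrite /= in_itv /= => /(_ l1 U Ul) aU.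
have {}aU : \forall x \near F, `[-1, 1]%classic (v x) -> U (acos (v x)).
  exact: vl aU.
by apply: filterS2 v1 aU => x v1x; apply; rewrite /= in_itv.
Qed.

(** The change of variables u = v(x) in the integral of 1 / sqrt(1 - u^2), for a
    decreasing v with derivative -g. *)
Lemma integral_acos (v g : R -> R) (c d : R) : c < d ->
  {within `[c, d], continuous v} ->
  {in `]c, d[, continuous g} ->
  (forall x, x \in `]c, d[ -> is_derive x 1 v (- g x)) ->
  (forall x, x \in `]c, d[ -> -1 < v x < 1) ->
  -1 <= v c <= 1 -> -1 <= v d <= 1 ->
  (forall x, x \in `]c, d[ -> 0 <= g x) ->
  (\int[mu]_(x in `]c, d[) (g x / Num.sqrt (1 - v x ^+ 2))%:E =
    (acos (v d) - acos (v c))%:E)%E.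
Proof.
move=> cd cv cg dv v1 vc1 vd1 g0.
have s0 x : x \in `]c, d[ -> 0 < 1 - v x ^+ 2.
  by move=> /v1 ?; rewrite subr_gt0; nra.
have dF x : x \in `]c, d[ ->
    is_derive x 1 (acos \o v) (g x / Num.sqrt (1 - v x ^+ 2)).
  move=> xI; rewrite mulrC -mulrNN; apply: is_derive1_comp; last exact: dv.
  exact/is_derive1_acos/v1.
have [cv1 cv2 cv3] := (continuous_within_itvP _ cd).1 cv.
apply: (@ge0_FTC2_oo R _ (acos \o v)) => //.
- apply/(continuous_within_itvP _ cd); split.
  + move=> x /dF[dFx _]; exact/differentiable_continuous/derivable1_diffP.
  + apply: cvg_acos => //; near=> x; have xI : x \in `]c, d[.
      by rewrite in_itv/=; apply/andP; split.
    by have /andP[? ?] := v1 _ xI; rewrite !ltW.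
  + apply: cvg_acos => //; near=> x; have xI : x \in `]c, d[.
      by rewrite in_itv/=; apply/andP; split.
    by have /andP[? ?] := v1 _ xI; rewrite !ltW.
- move=> x xI; apply: cvgM; first exact: cg.
  apply: cvgV; first by rewrite sqrtr_eq0 -ltNge s0.
  have dvx := dv x xI.
  have cs : {for x, continuous (fun z => 1 - v z ^+ 2)}.
    exact/differentiable_continuous/derivable1_diffP/ex_derive.
  exact: (continuous_comp cs (@sqrt_continuous _ _)).
- by move=> x xI; rewrite divr_ge0// g0.
Unshelve. all: by end_near. Qed.

End arccosine_primitive.

(** * The arcsine kernel *)
Section discriminant.
Context {R : realType}.
Notation mu := (@lebesgue_measure R).
Implicit Types a b x : R.

(** The discriminant of a y^2 - (1 + a + b t) y + (1 + t) at t = -x. *)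
Definition disc a b x : R := (1 + a - b * x) ^+ 2 - 4 * a * (1 - x).

(** Zero where the discriminant is nonnegative, because the square root of a
    negative number and the inverse of 0 are both 0. *)
Definition arcsine_kernel a b x : R := (Num.sqrt (- disc a b x))^-1.

Lemma arcsine_kernel_eq0 a b x : 0 <= disc a b x -> arcsine_kernel a b x = 0.
Proof. by move=> d0; rewrite /arcsine_kernel ler0_sqrtr ?invr0// oppr_le0. Qed.

Lemma arcsine_kernel_ge0 a b x : 0 <= arcsine_kernel a b x.
Proof. by rewrite invr_ge0. Qed.

(** The arccosine, extended by pi to the left of -1 and by 0 to the right of
    1. *)
Definition acos_ext (u : R) : R := acos (Num.max (-1) (Num.min 1 u)).

(** With rho = 2 sqrt (a (1 - x)) and u = (1 + a - b x) / rho, one has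
    - disc a b x = rho^2 (1 - u^2). *)
Definition arc_angle a b x : R :=
  acos_ext ((1 + a - b * x) / (2 * Num.sqrt (a * (1 - x)))).

Lemma subr1_sqr_le0 (u : R) : (1 <= u) || (u <= -1) -> 1 - u ^+ 2 <= 0.
Proof. by case/orP => ?; nra. Qed.

Lemma subr1_sqr_gt0 (u : R) : -1 < u < 1 -> 0 < 1 - u ^+ 2.
Proof. by case/andP => ? ?; nra. Qed.

(** As a function of b, u decreases affinely with slope - x / rho, so that
    acos(u) / x is a primitive of the kernel where |u| < 1. At b = 1 one has
    u >= 1 by the arithmetic-geometric inequality 2 sqrt (a (1 - x)) <= a + 1 - x,
    so the support of the kernel lies in b >= 1. *)
Lemma integral_arcsine_kernel_b a B x : 0 < a <= 1 -> 1 < B -> 0 < x < 1 ->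
  (\int[mu]_(b in `]1%R, B[) (arcsine_kernel a b x)%:E = (x^-1 * arc_angle a B x)%:E)%E.
Proof.
move=> /andP[a0 a1] B1 /andP[x0 x1].
have ax0 : 0 < a * (1 - x) by rewrite mulr_gt0// subr_gt0.
rewrite /arc_angle; set rho := 2 * _.
have rho0 : 0 < rho by rewrite mulr_gt0// sqrtr_gt0.
have rho2 : rho ^+ 2 = 4 * a * (1 - x).
  by rewrite exprMn sqr_sqrtr ?ltW//; ring.
pose u b := (1 + a - b * x) / rho.
have discE b : - disc a b x = rho ^+ 2 * (1 - u b ^+ 2).
  by rewrite /disc -rho2 /u; field; rewrite gt_eqF.
(* u decreases from 1 to -1 on [bm, bp] *)
pose bm := (1 + a - rho) / x; pose bp := (1 + a + rho) / x.
have bm1 : 1 <= bm.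
  rewrite ler_pdivlMr// mul1r.
  have : rho <= 1 + a - x.
    rewrite -[_ <= _](@ler_pXn2r _ 2)// ?nnegrE; [|exact: ltW|lra].
    by rewrite rho2; have := sqr_ge0 (1 - x - a); nra.
  lra.
have ubm : u bm = 1 by rewrite /u /bm; field; rewrite !gt_eqF.
have ubp : u bp = -1 by rewrite /u /bp; field; rewrite !gt_eqF.
have u_dec b b' : (u b < u b') = (b' < b).
  by rewrite /u ltr_pM2r ?invr_gt0// ltrD2l ltrN2 ltr_pM2r.
have u_dec' b b' : (u b <= u b') = (b' <= b) by rewrite !leNgt u_dec.
have k0 b : ~~ (bm < b < bp) -> arcsine_kernel a b x = 0.
  rewrite negb_and -!leNgt -(u_dec' bm) -(u_dec' b) ubm ubp => ub; apply: arcsine_kernel_eq0.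
  rewrite -oppr_le0 discE; rewrite pmulr_rle0 ?exprn_gt0//; exact: subr1_sqr_le0.
rewrite -/(u B) /acos_ext.
have [Bbm|Bbm] := leP B bm.
  have uB1 : 1 <= u B by rewrite -ubm u_dec'.
  rewrite min_l// max_r; last by lra.
  by rewrite acos1 mulr0 integral0_eq// => b; rewrite /= in_itv /= => ?; rewrite k0//; lra.
pose E := Num.min B bp.
have bmbp : bm < bp by rewrite -u_dec ubm ubp; lra.
have bmE : bm < E by rewrite lt_min Bbm.
have -> : Num.max (-1) (Num.min 1 (u B)) = u E.
  rewrite min_r; last by rewrite -ubm u_dec' ltW.
  rewrite /E; case: (leP B bp) => h; first by rewrite max_r// -ubp u_dec'.
  by rewrite ubp max_l// -ubp u_dec' ltW.
transitivity (\int[mu]_(b in `]bm, E[) (arcsine_kernel a b x)%:E)%E.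
  rewrite integral_mkcond [RHS]integral_mkcond; apply: eq_integral => b _.
  rewrite !patchE !mem_setE /= !in_itv /=.
  case: ifPn => h1; case: ifPn => h2 //; rewrite k0//.
  - by apply: contra h2 => /andP[-> ?]; rewrite lt_min (andP h1).2.
  - move: h2 h1; rewrite lt_min => /and3P[h3 -> h4].
    by rewrite andbT -leNgt; move/le_lt_trans : bm1 => /(_ _ h3) h5; rewrite leNgt h5.
have uI b : b \in `]bm, E[ -> -1 < u b < 1.
  rewrite in_itv /= lt_min => /and3P[h1 h2 h3].
  by rewrite -{1}ubp -ubm !u_dec h1 h3.
have du b : is_derive b 1 u (- (x / rho)).
  rewrite /u; apply: is_derive_eq.
  by rewrite /GRing.scale /=; ring.
transitivity (\int[mu]_(b in `]bm, E[) (x^-1%:E * ((x / rho) / Num.sqrt (1 - u b ^+ 2))%:E))%E.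
  apply: eq_integral => b /set_mem /= bI.
  rewrite -EFinM; congr EFin; rewrite /arcsine_kernel discE sqrtrM ?exprn_ge0 ?ltW//.
  rewrite sqrtr_sqr gtr0_norm// invfM; field.
  by rewrite !gt_eqF// sqrtr_gt0 subr1_sqr_gt0// uI.
have cu : continuous u.
  by move=> b; have [d _] := du b; exact/differentiable_continuous/derivable1_diffP.
rewrite ge0_integralZl//=.
- rewrite (@integral_acos _ u (fun=> x / rho))//.
  + by rewrite ubm acos1 subr0.
  + exact: continuous_subspaceT.
  + by move=> b _; exact: cst_continuous.
  + by rewrite ubm; lra.
  + apply/andP; split; last by rewrite -ubm u_dec' ltW.
    by rewrite -ubp u_dec' ge_min lexx orbT.
  + by move=> b _; rewrite divr_ge0 ?ltW.
- apply/measurable_EFinP/measurable_funM => //.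
  apply: (measurableT_comp (@measurable_inv R)).
  apply: (measurableT_comp (continuous_measurable_fun (@sqrt_continuous R))).
  apply: measurable_funB => //; apply: measurable_funX.
  apply: measurable_funTS; exact: continuous_measurable_fun.
- by move=> b /= bI; rewrite lee_fin mulr_ge0 ?invr_ge0// divr_ge0// ltW.
- by rewrite lee_fin invr_ge0 ltW.
Qed.

End discriminant.

(** * The arcsine laws *)
Section arcsine_law.
Context {R : realType}.
Notation mu := (@lebesgue_measure R).
Implicit Types a b x t : R.

(** Centre and radius of the interval on which disc a b is negative; for
    b = e^lambda its end points are t_minus and t_plus. *)
Definition arc_mid a b : R := (1 - a / b + a * (1 - b^-1)) / b.
Definition arc_rad a b : R := 2 * (Num.sqrt (1 - a / b) * Num.sqrt (a * (1 - b^-1))) / b.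

Lemma arc_coefs_ge0 a b : 0 <= a <= 1 -> 1 < b ->
  0 <= 1 - a / b /\ 0 <= a * (1 - b^-1).
Proof.
move=> /andP[a0 a1] b1; have b0 : 0 < b by lra.
split; first by rewrite subr_ge0 ler_pdivrMr// mul1r; lra.
by rewrite mulr_ge0// subr_ge0 invf_le1// ltW.
Qed.

Lemma arc_rad_sqr a b : 0 <= a <= 1 -> 1 < b ->
  arc_rad a b ^+ 2 = 4 * ((1 - a / b) * (a * (1 - b^-1))) / b ^+ 2.
Proof.
move=> a01 b1; have [h1 h2] := arc_coefs_ge0 a01 b1.
by rewrite /arc_rad expr_div_n exprMn exprMn !sqr_sqrtr//; congr (_ / _); ring.
Qed.

Lemma arc_rad_gt0 a b : 0 < a <= 1 -> 1 < b -> 0 < arc_rad a b.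
Proof.
move=> /andP[a0 a1] b1; have b0 : 0 < b by lra.
rewrite divr_gt0// mulr_gt0// mulr_gt0// sqrtr_gt0 ?mulr_gt0// subr_gt0.
  by rewrite ltr_pdivrMr// mul1r; lra.
by rewrite invf_lt1.
Qed.

Lemma disc_arc a b x : 0 <= a <= 1 -> 1 < b ->
  disc a b x = b ^+ 2 * ((x - arc_mid a b) ^+ 2 - arc_rad a b ^+ 2).
Proof.
move=> a01 b1; rewrite arc_rad_sqr// /disc /arc_mid.
by field; rewrite gt_eqF//; lra.
Qed.

(** The centre lies in [0, 1], and disc a b is a square, hence nonnegative, at
    x = 0 and at x = 1. *)
Lemma arc_bounds a b : 0 <= a <= 1 -> 1 < b ->
  0 <= arc_mid a b - arc_rad a b /\ arc_mid a b + arc_rad a b <= 1.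
Proof.
move=> /[dup] a01 /andP[a0 a1] b1; have b0 : 0 < b by lra.
have r0 : 0 <= arc_rad a b.
  by rewrite divr_ge0 ?mulr_ge0 ?sqrtr_ge0// ltW.
have m0 : 0 <= arc_mid a b.
  have [h1 h2] := arc_coefs_ge0 a01 b1.
  by apply: divr_ge0; [exact: addr_ge0|exact: ltW].
have m1 : 0 <= 1 - arc_mid a b.
  have -> : 1 - arc_mid a b = (b * (b - 1) + a * (2 - b)) / b ^+ 2.
    by rewrite /arc_mid; field; rewrite gt_eqF.
  have q : 0 <= b * (b - 1) + a * (2 - b) by clear -a0 a1 b1; nra.
  by rewrite divr_ge0 ?exprn_ge0 ?(ltW b0).
have d0 : arc_rad a b ^+ 2 <= arc_mid a b ^+ 2.
  have := disc_arc 0 a01 b1; rewrite /disc sub0r sqrrN => h.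
  have e : (1 + a - b * 0) ^+ 2 - 4 * a * (1 - 0) = (1 - a) ^+ 2 by ring.
  rewrite e in h; rewrite -subr_ge0 -(pmulr_rge0 _ (exprn_gt0 2 b0)) -h; exact: sqr_ge0.
have d1 : arc_rad a b ^+ 2 <= (1 - arc_mid a b) ^+ 2.
  have := disc_arc 1 a01 b1; rewrite /disc => h.
  have e : (1 + a - b * 1) ^+ 2 - 4 * a * (1 - 1) = (1 + a - b) ^+ 2 by ring.
  rewrite e in h; rewrite -subr_ge0 -(pmulr_rge0 _ (exprn_gt0 2 b0)) -h; exact: sqr_ge0.
split.
  by rewrite subr_ge0 -(@ler_pXn2r _ 2)// nnegrE.
by rewrite addrC -lerBrDr -(@ler_pXn2r _ 2)// nnegrE.
Qed.

(** The common part of the two integrals below: v decreases from 1 to -1 on the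
    support of the kernel, and the weighted kernel is k times the derivative of
    acos(v). *)
Lemma integral_arcsine_kernel_x a b (w v g : R -> R) (k : R) :
  let c := arc_mid a b - arc_rad a b in
  let d := arc_mid a b + arc_rad a b in
  0 < a <= 1 -> 1 < b -> 0 <= k ->
  {within `[c, d], continuous v} ->
  {in `]c, d[, continuous g} ->
  (forall x, x \in `]c, d[ -> is_derive x 1 v (- g x)) ->
  (forall x, x \in `]c, d[ -> -1 < v x < 1) ->
  v c = 1 -> v d = -1 ->
  (forall x, x \in `]c, d[ -> 0 <= g x) ->
  (forall x, x \in `]c, d[ ->
     arcsine_kernel a b x * w x = k * (g x / Num.sqrt (1 - v x ^+ 2))) ->
  (\int[mu]_(x in `]0%R, 1%R[) (arcsine_kernel a b x * w x)%:E = (k * pi)%:E)%E.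
Proof.
move=> c d /[dup] a01' /andP[a0 a1] b1 k0 cv cg dv v1 vc vd g0 Kw.
have b0 : 0 < b by lra.
have a01 : 0 <= a <= 1 by lra.
have r0 := arc_rad_gt0 a01' b1.
have [c0 d1] := arc_bounds a01 b1.
have cd : c < d by rewrite /c /d; lra.
have Kout x : x \notin `]c, d[ -> arcsine_kernel a b x = 0.
  rewrite in_itv/= negb_and -!leNgt => xcd; apply: arcsine_kernel_eq0.
  rewrite disc_arc// mulr_ge0 ?exprn_ge0 ?(ltW b0)//.
  have -> : (x - arc_mid a b) ^+ 2 - arc_rad a b ^+ 2 = (x - c) * (x - d).
    by rewrite /c /d; ring.
  case/orP : xcd => ?; first by rewrite mulr_le0 ?subr_le0 ?(le_trans _ (ltW cd)).
  by rewrite mulr_ge0 ?subr_ge0 ?(le_trans (ltW cd)).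
transitivity (\int[mu]_(x in `]c, d[) (k%:E * (g x / Num.sqrt (1 - v x ^+ 2))%:E))%E.
  rewrite integral_mkcond [RHS]integral_mkcond; apply: eq_integral => x _.
  rewrite !patchE !mem_setE.
  have [xcd|xcd] := boolP (x \in `]c, d[); last by rewrite Kout// mul0r if_same.
  rewrite -EFinM -Kw// ifT//; move: xcd; rewrite !in_itv/= => /andP[h1 h2].
  by rewrite (le_lt_trans c0)// (lt_le_trans h2).
have mq : measurable_fun `]c, d[ (fun x => g x / Num.sqrt (1 - v x ^+ 2)).
  have cv' : {in `]c, d[, continuous v} by case/(continuous_within_itvP _ cd) : cv.
  apply: measurable_funM.
    by apply: open_continuous_measurable_fun => // x /set_mem; exact: cg.
  apply: (measurableT_comp (@measurable_inv R)).
  apply: (measurableT_comp (continuous_measurable_fun (@sqrt_continuous R))).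
  apply: measurable_funB => //; apply: measurable_funX.
  by apply: open_continuous_measurable_fun => // x /set_mem; exact: cv'.
rewrite ge0_integralZl//=.
- rewrite (@integral_acos _ v g)//; first by rewrite vc vd acos1 acosN1 subr0.
  + by rewrite vc; lra.
  + by rewrite vd; lra.
- exact/measurable_EFinP.
- by move=> x xcd; rewrite lee_fin divr_ge0// g0.
Qed.

Lemma mass_arcsine_kernel a b : 0 < a <= 1 -> 1 < b ->
  (\int[mu]_(x in `]0%R, 1%R[) (arcsine_kernel a b x)%:E = (pi / b)%:E)%E.
Proof.
move=> /[dup] a01' /andP[a0 a1] b1.
have b0 : 0 < b by lra.
have a01 : 0 <= a <= 1 by lra.
have r0 := arc_rad_gt0 a01' b1.
set m := arc_mid a b; set r := arc_rad a b in r0.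
have dv x : is_derive x 1 (fun x => (m - x) / r) (- r^-1).
  by apply: is_derive_eq; rewrite /GRing.scale /=; ring.
rewrite -[pi / b]mulrC -(@integral_arcsine_kernel_x a b (fun=> 1)
  (fun x => (m - x) / r) (fun=> r^-1) b^-1)// -/m -/r.
- by apply: eq_integral => x _; rewrite mulr1.
- by rewrite invr_ge0 ltW.
- apply: continuous_subspaceT => x; have [d _] := dv x.
  exact/differentiable_continuous/derivable1_diffP.
- by move=> x _; exact: cst_continuous.
- by move=> x; rewrite in_itv/= ltr_pdivlMr// ltr_pdivrMr//; lra.
- by field; rewrite gt_eqF.
- by field; rewrite gt_eqF.
- by move=> x _; rewrite invr_ge0 ltW.
- move=> x; rewrite in_itv/= => xI.
  have y0 : 0 < 1 - ((m - x) / r) ^+ 2.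
    by apply: subr1_sqr_gt0; rewrite ltr_pdivlMr// ltr_pdivrMr//; lra.
  rewrite mulr1 /arcsine_kernel disc_arc// -/m -/r.
  have -> : - (b ^+ 2 * ((x - m) ^+ 2 - r ^+ 2)) = (b * r) ^+ 2 * (1 - ((m - x) / r) ^+ 2).
    by field; rewrite gt_eqF.
  rewrite sqrtrM ?sqr_ge0// sqrtr_sqr gtr0_norm; last exact: mulr_gt0.
  by rewrite invfM [X in X * _ = _]invfM -mulrA.
Qed.

(** The affine function of 1 / (t + x) that maps the end points of the support
    to 1 and -1 plays the role of v. *)
Lemma cauchy_arcsine_kernel a b t : 0 < a <= 1 -> 1 < b -> 0 < t ->
  (\int[mu]_(x in `]0%R, 1%R[) (arcsine_kernel a b x * (t / (t + x)))%:E =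
   (pi * (t / Num.sqrt (disc a b (- t))))%:E)%E.
Proof.
move=> /[dup] a01' /andP[a0 a1] b1 t0.
have b0 : 0 < b by lra.
have a01 : 0 <= a <= 1 by lra.
have r0 := arc_rad_gt0 a01' b1.
have [c0 d1] := arc_bounds a01 b1.
have dE := disc_arc (- t) a01 b1.
have dK x := disc_arc x a01 b1.
set m := arc_mid a b in c0 d1 dE dK *; set r := arc_rad a b in r0 c0 d1 dE dK *.
(* b^2 P = disc a b (- t), by disc_arc *)
pose P := (m + t) ^+ 2 - r ^+ 2.
have P0 : 0 < P by rewrite /P subr_sqr mulr_gt0//; lra.
pose v x := (P / (t + x) - (m + t)) / r.
pose g x := P / (r * (t + x) ^+ 2).
have y0 x : x \in `]m - r, m + r[ -> 0 < t + x.
  by rewrite in_itv/= => /andP[h _]; lra.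
have y0' x : x \in `[m - r, m + r] -> 0 < t + x.
  by rewrite in_itv/= => /andP[h _]; lra.
have dv x : 0 < t + x -> is_derive x 1 v (- g x).
  move=> tx0; have txN0 : t + x != 0 by rewrite gt_eqF.
  rewrite /v /g; apply: is_derive_eq; rewrite /GRing.scale /=.
  by field; rewrite !gt_eqF.
have vE x : 0 < t + x -> 1 - v x ^+ 2 = P * (r ^+ 2 - (x - m) ^+ 2) / (r * (t + x)) ^+ 2.
  by move=> tx0; rewrite /v /P; field; rewrite !gt_eqF.
have q0 x : x \in `]m - r, m + r[ -> 0 < r ^+ 2 - (x - m) ^+ 2.
  by rewrite in_itv/= => /andP[h1 h2]; rewrite subr_sqr mulr_gt0//; lra.
have s0 : 0 < Num.sqrt P by rewrite sqrtr_gt0.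
have -> : pi * (t / Num.sqrt (disc a b (- t))) = t / (b * Num.sqrt P) * pi.
  rewrite dE (_ : (- t - m) ^+ 2 - r ^+ 2 = P); last by rewrite /P; ring.
  by rewrite sqrtrM ?sqr_ge0// sqrtr_sqr gtr0_norm// mulrC.
have := @integral_arcsine_kernel_x a b (fun x => t / (t + x)) v g (t / (b * Num.sqrt P)).
rewrite /= -/m -/r; apply.
- exact: a01'.
- exact: b1.
- by rewrite divr_ge0 ?mulr_ge0 ?(ltW b0) ?(ltW s0) ?(ltW t0).
- apply: derivable_within_continuous => x /y0' tx0.
  by have [] := dv x tx0.
- move=> x /y0 tx0.
  have txN0 : r * (t + x) ^+ 2 != 0 by rewrite mulf_neq0 ?expf_neq0 ?gt_eqF.
  apply: (@differentiable_continuous _ R^o R^o); apply/derivable1_diffP.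
  by rewrite /g; exact: ex_derive.
- by move=> x /y0; exact: dv.
- move=> x xI; have tx0 := y0 x xI; rewrite -ltr_norml -(@ltr_pXn2r _ 2)// ?nnegrE//.
  rewrite expr1n real_normK ?num_real// -subr_gt0 vE//.
  by apply: divr_gt0; [apply: mulr_gt0 => //; exact: q0|apply/exprn_gt0/mulr_gt0].
- have h1 : t + (m - r) != 0 by apply: lt0r_neq0; lra.
  by rewrite /v /P; field; rewrite h1 lt0r_neq0.
- have h1 : t + (m + r) != 0 by apply: lt0r_neq0; lra.
  by rewrite /v /P; field; rewrite h1 lt0r_neq0.
- move=> x /y0 tx0; apply: divr_ge0; first exact: ltW.
  by apply: mulr_ge0; [exact: ltW|exact/exprn_ge0/ltW].
- move=> x xI; have tx0 := y0 x xI; have qx0 := q0 x xI.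
  rewrite vE// sqrtrM ?mulr_ge0 ?(ltW P0) ?(ltW qx0)//.
  rewrite sqrtrV ?sqr_ge0// sqrtr_sqr gtr0_norm; last exact: mulr_gt0.
  rewrite sqrtrM ?(ltW P0)// /arcsine_kernel dK.
  rewrite (_ : - (b ^+ 2 * _) = b ^+ 2 * (r ^+ 2 - (x - m) ^+ 2)); last by ring.
  rewrite sqrtrM ?sqr_ge0// sqrtr_sqr gtr0_norm//.
  have -> : g x = Num.sqrt P ^+ 2 / (r * (t + x) ^+ 2) by rewrite sqr_sqrtr ?(ltW P0).
  have h1 : Num.sqrt (r ^+ 2 - (x - m) ^+ 2) != 0 by rewrite lt0r_neq0// sqrtr_gt0.
  by field; rewrite h1 !lt0r_neq0.
Qed.

End arcsine_law.

(** * The limit measure as a superposition of arcsine laws *)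
Section tonelli.
Context {R : realType}.
Notation mu := (@lebesgue_measure R).

Lemma tonelli_restrict (A B : set (measurableTypeR R)) (f : R -> R -> R) :
  measurable A -> measurable B ->
  measurable_fun setT (fun z : measurableTypeR R * measurableTypeR R => f z.1 z.2) ->
  (forall x y, A x -> 0 <= f x y) ->
  (\int[mu]_(x in A) \int[mu]_(y in B) (f x y)%:E =
   \int[mu]_(y in B) \int[mu]_(x in A) (f x y)%:E)%E.
Proof.
move=> mA mB mf f0.
pose h (z : measurableTypeR R * measurableTypeR R) :=
  (\1_A z.1 * \1_B z.2 * f z.1 z.2)%:E.
have mh : measurable_fun setT h.
  apply/measurable_EFinP/measurable_funM => //; apply: measurable_funM.
  - exact: (measurableT_comp (measurable_indic mA) measurable_fst).
  - exact: (measurableT_comp (measurable_indic mB) measurable_snd).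
have h0 z : (0 <= h z)%E.
  rewrite lee_fin /h !indicE; have [zA|_] := boolP (z.1 \in A).
    by rewrite !mulr_ge0// f0//; exact: set_mem.
  by rewrite !mul0r.
have := @fubini_tonelli _ _ _ _ R mu mu h mh h0.
have -> : (\int[mu]_x \int[mu]_y h (x, y) =
    \int[mu]_(x in A) \int[mu]_(y in B) (f x y)%:E)%E.
  rewrite [RHS]integral_mkcond; apply: eq_integral => x _.
  rewrite patchE /h /= indicE; case: ifPn => xA; last first.
    by apply: integral0_eq => y _; rewrite !mul0r.
  rewrite [RHS]integral_mkcond; apply: eq_integral => y _.
  by rewrite patchE indicE mul1r; case: ifPn; rewrite ?mul1r ?mul0r.
move=> ->.
rewrite [RHS]integral_mkcond; apply: eq_integral => y _.
rewrite patchE /h /= indicE; case: ifPn => yB; last first.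
  by apply: integral0_eq => x _; rewrite mulr0 mul0r.
rewrite [RHS]integral_mkcond; apply: eq_integral => x _.
by rewrite patchE indicE mulr1; case: ifPn; rewrite ?mul1r ?mul0r.
Qed.

End tonelli.

Section average_of_arcsine_laws.
Context {R : realType}.
Notation mu := (@lebesgue_measure R).
Implicit Types a b t : R.

Lemma disc_opp_gt0 a b t : 0 <= a <= 1 -> 1 <= b -> 0 < t -> 0 < disc a b (- t).
Proof.
move=> /andP[a0 a1] b1 t0.
have h : 0 < (1 + t - a) ^+ 2 by rewrite exprn_gt0//; lra.
have h1 : 0 <= (b - 1) * t by rewrite mulr_ge0 ?subr_ge0 ?(ltW t0).
rewrite /disc; have -> : (1 + a - b * - t) ^+ 2 - 4 * a * (1 - - t) =
  (1 + t - a) ^+ 2 + (b - 1) * t * (2 * (1 + a + t) + (b - 1) * t) by ring.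
apply: ltr_pwDl => //; apply: mulr_ge0 => //; lra.
Qed.

(** This is -ln y, where y is the smaller root of
    a y^2 - (1 + a + b t) y + (1 + t), written as 2 (1 + t) / (1 + a + b t +
    sqrt disc) in order to cover a = 0. *)
Definition log_root a b t : R :=
  ln (1 + a + b * t + Num.sqrt (disc a b (- t))) - ln (2 * (1 + t)).

Lemma log_root1 a t : 0 <= a <= 1 -> 0 < t -> log_root a 1 t = 0.
Proof.
move=> a01 t0; rewrite /log_root /disc.
have -> : (1 + a - 1 * - t) ^+ 2 - 4 * a * (1 - - t) = (1 + t - a) ^+ 2 by ring.
rewrite sqrtr_sqr ger0_norm; last by move: a01 t0; lra.
have -> : 1 + a + 1 * t + (1 + t - a) = 2 * (1 + t) by ring.
by rewrite subrr.
Qed.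

Lemma is_derive_log_root a b t : 0 <= a <= 1 -> 1 <= b -> 0 < t ->
  is_derive b 1 (fun b => log_root a b t) (t / Num.sqrt (disc a b (- t))).
Proof.
move=> a01 b1 t0; have D0 := disc_opp_gt0 a01 b1 t0.
set D := disc a b (- t) in D0 *.
have S0 : 0 < Num.sqrt D by rewrite sqrtr_gt0.
have dD : is_derive b 1 (fun b => disc a b (- t)) (2 * t * (1 + a + b * t)).
  rewrite /disc; apply: is_derive_eq; rewrite /GRing.scale /=; ring.
have dS : is_derive b 1 (Num.sqrt \o (fun b => disc a b (- t)))
    ((2 * Num.sqrt D)^-1 * (2 * t * (1 + a + b * t))).
  by apply: is_derive1_comp => //; exact: is_derive1_sqrt.
have dL : is_derive b 1 (fun b => 1 + a + b * t) t.
  by apply: is_derive_eq; rewrite /GRing.scale /=; ring.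
have dA : is_derive b 1 (fun b => 1 + a + b * t + Num.sqrt (disc a b (- t)))
    (t + (2 * Num.sqrt D)^-1 * (2 * t * (1 + a + b * t))).
  exact: is_deriveD.
have A0 : 0 < 1 + a + b * t + Num.sqrt D.
  have : 0 < b * t by rewrite mulr_gt0//; lra.
  lra.
have dln := @is_derive1_comp R (@ln R) _ b _ _ (is_derive1_ln A0) dA.
rewrite /log_root; apply: (is_derive_eq (is_deriveB dln (is_derive_cst _ _ _))).
rewrite subr0; field.
by rewrite !lt0r_neq0.
Qed.

Lemma integral_log_root a B t : 0 <= a <= 1 -> 1 < B -> 0 < t ->
  (\int[mu]_(b in `]1%R, B[) (t / Num.sqrt (disc a b (- t)))%:E = (log_root a B t)%:E)%E.
Proof.
move=> a01 B1 t0.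
have -> : log_root a B t = log_root a B t - log_root a 1 t.
  by rewrite log_root1// subr0.
apply: (@ge0_FTC2_oo R _ (fun b => log_root a b t)) => //.
- apply: derivable_within_continuous => b; rewrite in_itv/= => /andP[b1 _].
  by have [] := is_derive_log_root a01 b1 t0.
- move=> b; rewrite in_itv/= => /andP[/ltW b1 _].
  have D0 := disc_opp_gt0 a01 b1 t0.
  apply: cvgM; first exact: cvg_cst.
  apply: cvgV; first by rewrite lt0r_neq0// sqrtr_gt0.
  have cs : {for b, continuous (fun b => disc a b (- t))}.
    apply/differentiable_continuous/derivable1_diffP; rewrite /disc; exact: ex_derive.
  exact: (continuous_comp cs (@sqrt_continuous _ _)).
- move=> b; rewrite in_itv/= => /andP[/ltW b1 _]; exact: is_derive_log_root.
- by move=> b _; rewrite divr_ge0// ltW.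
Qed.

Lemma integral_inv B : 1 < B ->
  (\int[mu]_(b in `]1%R, B[) (b^-1)%:E = (ln B)%:E)%E.
Proof.
move=> B1.
have d b : 0 < b -> is_derive b 1 (@ln R) b^-1 by exact: is_derive1_ln.
have -> : ln B = ln B - ln 1 by rewrite ln1 subr0.
apply: (@ge0_FTC2_oo R _ (@ln R)) => //.
- apply: derivable_within_continuous => b; rewrite in_itv/= => /andP[b1 _].
  by have [] := d b (lt_le_trans ltr01 b1).
- move=> b; rewrite in_itv/= => /andP[b1 _].
  by apply: inv_continuous; rewrite lt0r_neq0// (lt_trans _ b1).
- move=> b; rewrite in_itv/= => /andP[b1 _]; apply: d; exact: lt_trans b1.
- move=> b; rewrite in_itv/= => /andP[b1 _].
  by rewrite invr_ge0 (le_trans ler01)// ltW.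
Qed.

Lemma measurable_arcsine_kernel2 a : measurable_fun setT
  (fun z : measurableTypeR R * measurableTypeR R => arcsine_kernel a z.2 z.1).
Proof.
apply: (measurableT_comp (@measurable_inv R)).
apply: (measurableT_comp (continuous_measurable_fun (@sqrt_continuous R))).
apply: (measurableT_comp (@oppr_measurable R setT)); apply: measurable_funB.
  apply: measurable_funX; apply: measurable_funB => //.
  by apply: measurable_funM; [exact: measurable_snd|exact: measurable_fst].
by apply: measurable_funM => //; exact: measurable_funB.
Qed.

(** Tonelli's theorem, since arc_angle / x is the integral of the kernel over
    b. *)
Lemma integral_arc_angle a B (w : R -> R) : 0 < a <= 1 -> 1 < B ->
  measurable_fun setT w -> (forall x, x \in `]0, 1[ -> 0 <= w x) ->
  (\int[mu]_(x in `]0%R, 1%R[) (x^-1 * arc_angle a B x * w x)%:E =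
   \int[mu]_(b in `]1%R, B[) \int[mu]_(x in `]0%R, 1%R[) (arcsine_kernel a b x * w x)%:E)%E.
Proof.
move=> a01 B1 mw w0.
rewrite -(@tonelli_restrict R _ _ (fun x b => arcsine_kernel a b x * w x))//.
- apply: eq_integral => x /set_mem /= xI.
  have x01 : 0 < x < 1 by move: xI; rewrite in_itv.
  rewrite EFinM -(integral_arcsine_kernel_b a01 B1 x01).
  under [RHS]eq_integral do rewrite EFinM.
  rewrite ge0_integralZr//.
  + apply/measurable_EFinP; apply: measurable_funTS.
    apply: (measurableT_comp (@measurable_arcsine_kernel2 a)
      (measurable_pair1 x)).
  + by move=> b _; rewrite lee_fin arcsine_kernel_ge0.
  + by rewrite lee_fin w0.
- apply: measurable_funM; first exact: measurable_arcsine_kernel2.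
  exact: (measurableT_comp mw measurable_fst).
- by move=> x b xI; rewrite mulr_ge0 ?arcsine_kernel_ge0 ?w0.
Qed.

Lemma mass_arc_angle a B : 0 < a <= 1 -> 1 < B ->
  (\int[mu]_(x in `]0%R, 1%R[) (x^-1 * arc_angle a B x)%:E = (pi * ln B)%:E)%E.
Proof.
move=> a01 B1; have := @integral_arc_angle a B (fun=> 1) a01 B1.
under eq_integral do rewrite mulr1.
move=> ->//.
transitivity (\int[mu]_(b in `]1%R, B[) (pi%:E * (b^-1)%:E))%E.
  apply: eq_integral => b /set_mem /=; rewrite in_itv/= => /andP[b1 _].
  under eq_integral do rewrite mulr1.
  by rewrite mass_arcsine_kernel.
rewrite ge0_integralZl//=; first by rewrite integral_inv.
- apply/measurable_EFinP/measurable_funTS; exact: measurable_inv.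
- by move=> b; rewrite in_itv/= => /andP[b1 _]; rewrite lee_fin invr_ge0 (le_trans ler01)// ltW.
- by rewrite lee_fin pi_ge0.
Qed.

Lemma cauchy_arc_angle a B t : 0 < a <= 1 -> 1 < B -> 0 < t ->
  (\int[mu]_(x in `]0%R, 1%R[) (x^-1 * arc_angle a B x * (t / (t + x)))%:E =
   (pi * log_root a B t)%:E)%E.
Proof.
move=> /[dup] a01 /andP[a0 a1] B1 t0; rewrite integral_arc_angle//; last 2 first.
- apply: measurable_funM => //; apply: (measurableT_comp (@measurable_inv R)).
  exact: measurable_funD.
- by move=> x; rewrite in_itv/= => /andP[x0 _]; rewrite divr_ge0 ?addr_ge0 ?ltW.
transitivity (\int[mu]_(b in `]1%R, B[)
    (pi%:E * (t / Num.sqrt (disc a b (- t)))%:E))%E.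
  apply: eq_integral => b /set_mem /=; rewrite in_itv/= => /andP[b1 _].
  by rewrite cauchy_arcsine_kernel.
rewrite ge0_integralZl//=; first by rewrite integral_log_root// a1 ltW.
- apply/measurable_EFinP/measurable_funTS/measurable_funM => //.
  apply: (measurableT_comp (@measurable_inv R)).
  apply: (measurableT_comp (continuous_measurable_fun (@sqrt_continuous R))).
  rewrite /disc; apply: measurable_funB => //; apply: measurable_funX.
  by apply: measurable_funB => //; exact: measurable_funM.
- by move=> b _; rewrite lee_fin divr_ge0// ltW.
- by rewrite lee_fin pi_ge0.
Qed.

End average_of_arcsine_laws.

(** * The density of the limit measure *)
Section limit_density_theory.
Context {R : realType}.
Notation mu := (@lebesgue_measure R).
Implicit Types a b t x lambda : R.

Lemma t_plusE a lambda : 0 <= a <= 1 -> 0 < lambda ->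
  t_plus a lambda = arc_mid a (expR lambda) + arc_rad a (expR lambda).
Proof.
rewrite -expR_gt1 => a01 b1; have [h1 h2] := arc_coefs_ge0 a01 b1.
rewrite /t_plus expRN sqrrD !sqr_sqrtr// /arc_mid /arc_rad; ring.
Qed.

Lemma t_minusE a lambda : 0 <= a <= 1 -> 0 < lambda ->
  t_minus a lambda = arc_mid a (expR lambda) - arc_rad a (expR lambda).
Proof.
rewrite -expR_gt1 => a01 b1; have [h1 h2] := arc_coefs_ge0 a01 b1.
rewrite /t_minus expRN sqrrB !sqr_sqrtr// /arc_mid /arc_rad; ring.
Qed.

Lemma disc_t a lambda x : 0 <= a <= 1 -> 0 < lambda ->
  disc a (expR lambda) x =
  expR lambda ^+ 2 * ((x - t_minus a lambda) * (x - t_plus a lambda)).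
Proof.
move=> a01 l0; rewrite disc_arc ?expR_gt1// t_plusE// t_minusE//; ring.
Qed.

Lemma t_minus_ge0 a lambda : 0 <= t_minus a lambda.
Proof. by rewrite mulr_ge0 ?expR_ge0 ?sqr_ge0. Qed.

Lemma t_plus_ge0 a lambda : 0 <= t_plus a lambda.
Proof. by rewrite mulr_ge0 ?expR_ge0 ?sqr_ge0. Qed.

Lemma t_plus_le1 a lambda : 0 <= a <= 1 -> 0 < lambda -> t_plus a lambda <= 1.
Proof.
move=> a01 l0; rewrite t_plusE//.
by rewrite -expR_gt1 in l0; have [] := arc_bounds a01 l0.
Qed.

(** On [t_minus, t_plus] the complex number has modulus 2 sqrt (a (1 - x)).
    It is 0 exactly when a (1 - x) = 0, where arc_angle would be acos 0. *)
Lemma Arg_arc_angle a lambda x : 0 <= a <= 1 -> 0 < lambda ->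
  t_minus a lambda <= x <= t_plus a lambda ->
  Arg (Complex (a + 1 - expR lambda * x)
    (expR lambda * Num.sqrt ((x - t_minus a lambda) * (t_plus a lambda - x)))) =
  if a * (1 - x) == 0 then 0 else arc_angle a (expR lambda) x.
Proof.
move=> a01 l0 /andP[x1 x2]; set b := expR lambda.
have x1' : x <= 1 by rewrite (le_trans x2)// t_plus_le1.
have ax0 : 0 <= a * (1 - x) by rewrite mulr_ge0 ?subr_ge0//; case/andP: a01.
set N := a + 1 - b * x; set v := b * _.
have v0 : 0 <= v by rewrite mulr_ge0 ?expR_ge0 ?sqrtr_ge0.
have nE : Num.sqrt (N ^+ 2 + v ^+ 2) = 2 * Num.sqrt (a * (1 - x)).
  rewrite /v exprMn sqr_sqrtr; last by rewrite mulr_ge0 ?subr_ge0.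
  have -> : N ^+ 2 + b ^+ 2 * ((x - t_minus a lambda) * (t_plus a lambda - x)) =
      2 ^+ 2 * (a * (1 - x)).
    have := disc_t x a01 l0; rewrite /disc -/b /N => h.
    by apply/eqP; rewrite -subr_eq0; apply/eqP; move: h; lra.
  by rewrite sqrtrM ?exprn_ge0// sqrtr_sqr gtr0_norm.
rewrite /Arg /= v0 nE.
have [ax|axN0] := eqVneq (a * (1 - x)) 0.
  case: ifPn => // zN0; exfalso; move/negP : zN0; apply.
  move: nE; rewrite ax sqrtr0 mulr0 => /eqP; rewrite sqrtr_eq0 => h.
  have N0 : N ^+ 2 = 0 by have := sqr_ge0 N; have := sqr_ge0 v; lra.
  have v20 : v ^+ 2 = 0 by have := sqr_ge0 N; have := sqr_ge0 v; lra.
  by apply/eqP; congr Complex; apply/eqP; rewrite -sqrf_eq0 ?N0 ?v20.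
have r0 : 0 < 2 * Num.sqrt (a * (1 - x)).
  by rewrite mulr_gt0// sqrtr_gt0 lt0r axN0.
case: ifPn => [/eqP[N0 v00]|_].
  by move: r0; rewrite -nE N0 v00 expr0n addr0 sqrtr0 ltxx.
rewrite /arc_angle /acos_ext (addrC 1 a) -/N.
have NM : `|N| <= 2 * Num.sqrt (a * (1 - x)).
  by rewrite -nE -[`|N|]sqrtr_sqr ler_wsqrtr// lerDl sqr_ge0.
by move: NM; rewrite ler_norml => /andP[h1 h2]; rewrite min_r ?max_r//
  ?ler_pdivrMr ?ler_pdivlMr ?mul1r ?mulN1r.
Qed.

(** A form of the density in which measurability and positivity can be read
    off. *)
Lemma limit_densityE a lambda x : 0 <= a <= 1 -> 0 < lambda ->
  limit_density a lambda x =
  if (t_plus a lambda <= x <= 1) && (ln (1 + a) < lambda) then (lambda * x)^-1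
  else if t_minus a lambda <= x <= t_plus a lambda then
    (lambda * pi * x)^-1 * (if a * (1 - x) == 0 then 0 else arc_angle a (expR lambda) x)
  else 0.
Proof.
move=> a01 l0; rewrite /limit_density; case: ifPn => // _; case: ifPn => // h.
by rewrite Arg_arc_angle.
Qed.

Lemma clip_bound (u : R) : -1 <= Num.max (-1) (Num.min 1 u) <= 1.
Proof. by rewrite le_max lexx ge_max ge_min lexx andbT /=; lra. Qed.

Lemma acos_ext_ge0 u : 0 <= acos_ext u :> R.
Proof. exact/acos_ge0/clip_bound. Qed.

Lemma limit_density_ge0 a lambda x : 0 <= a <= 1 -> 0 < lambda ->
  0 <= limit_density a lambda x.
Proof.
move=> a01 l0; rewrite limit_densityE//; case: ifPn => [/andP[/andP[h _] _]|_].
  by rewrite invr_ge0 mulr_ge0 ?(ltW l0)// (le_trans _ h)// t_plus_ge0.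
case: ifPn => // /andP[h _]; rewrite mulr_ge0//.
  by rewrite invr_ge0 !mulr_ge0 ?pi_ge0 ?(ltW l0)// (le_trans _ h)// t_minus_ge0.
by case: ifPn => // _; exact: acos_ext_ge0.
Qed.

Lemma limit_density_out a lambda x : 0 <= a <= 1 -> 0 < lambda ->
  x \notin `[0, 1] -> limit_density a lambda x = 0.
Proof.
move=> a01 l0 x01; rewrite /limit_density ifF ?ifF//; apply/negbTE.
  apply: contra x01 => /andP[h1 h2]; rewrite in_itv/= (le_trans (t_minus_ge0 _ _) h1).
  by rewrite (le_trans h2)// t_plus_le1.
apply: contra x01 => /andP[/andP[h1 h2] _].
by rewrite in_itv/= (le_trans (t_plus_ge0 _ _) h1).
Qed.

Lemma measurable_acos_ext : measurable_fun [set: R] (@acos_ext R).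
Proof.
apply: (@measurable_comp _ _ _ _ _ _ `[(-1 : R), 1]%classic (@acos R)) => //.
- by move=> _ [u _ <-]; rewrite /= in_itv/= clip_bound.
- by apply: subspace_continuous_measurable_fun => //; exact: within_continuous_acos.
- by apply: measurable_maxr => //; exact: measurable_minr.
Qed.

Lemma measurable_arc_angle a b : measurable_fun [set: R] (arc_angle a b).
Proof.
apply: (measurableT_comp measurable_acos_ext); apply: measurable_funM.
  by apply: measurable_funB => //; exact: measurable_funM.
apply: (measurableT_comp (@measurable_inv R)); apply: measurable_funM => //.
apply: (measurableT_comp (continuous_measurable_fun (@sqrt_continuous R))).
by apply: measurable_funM => //; exact: measurable_funB.
Qed.

Lemma measurable_limit_density a lambda : 0 <= a <= 1 -> 0 < lambda ->
  measurable_fun [set: R] (limit_density a lambda).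
Proof.
move=> a01 l0; rewrite (_ : limit_density a lambda = fun x =>
  if (t_plus a lambda <= x <= 1) && (ln (1 + a) < lambda) then (lambda * x)^-1
  else if t_minus a lambda <= x <= t_plus a lambda then
    (lambda * pi * x)^-1 * (if a * (1 - x) == 0 then 0 else arc_angle a (expR lambda) x)
  else 0); last by apply/funext => x; exact: limit_densityE.
apply: measurable_fun_ifT.
- apply: measurable_and => //; apply: measurable_and.
    exact: measurable_fun_ler.
  exact: measurable_fun_ler.
- by apply: (measurableT_comp (@measurable_inv R)); exact: measurable_funM.
apply: measurable_fun_ifT => //.
- by apply: measurable_and; exact: measurable_fun_ler.
apply: measurable_funM.
  by apply: (measurableT_comp (@measurable_inv R)); exact: measurable_funM.
apply: measurable_fun_ifT => //; last exact: measurable_arc_angle.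
by apply: measurable_fun_eqr => //; apply: measurable_funM => //; exact: measurable_funB.
Qed.

(** The three cases of the density correspond to u <= -1, |u| <= 1 and u >= 1
    for the argument u of the arccosine. Where disc is nonnegative, |u| >= 1, and
    the sign of u is that of 1 + a - b x. It is positive to the left of t_minus;
    to the right of t_plus it is negative if b > 1 + a, and positive on ]0, 1[
    if b <= 1 + a. *)
Lemma limit_density_arc_angle a lambda x : 0 < a <= 1 -> 0 < lambda -> 0 < x < 1 ->
  limit_density a lambda x =
  (lambda * pi)^-1 * (x^-1 * arc_angle a (expR lambda) x).
Proof.
move=> /[dup] a01' /andP[a0 a1] l0 /andP[x0 x1].
have a01 : 0 <= a <= 1 by rewrite a1 ltW.
have b1 : 1 < expR lambda by rewrite expR_gt1.
rewrite limit_densityE//; set b := expR lambda in b1 *.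
have b0 : 0 < b by lra.
have ax0 : 0 < a * (1 - x) by rewrite mulr_gt0// subr_gt0.
have dE := disc_t x a01 l0; rewrite -/b in dE.
pose rho := 2 * Num.sqrt (a * (1 - x)).
have rho0 : 0 < rho by rewrite mulr_gt0// sqrtr_gt0.
have d0 : 0 <= disc a b x -> rho <= `|1 + a - b * x|.
  rewrite /disc subr_ge0 => h; rewrite -(@ler_pXn2r _ 2)// ?nnegrE ?(ltW rho0)//.
  rewrite real_normK ?num_real// (le_trans _ h)// /rho exprMn sqr_sqrtr ?(ltW ax0)//.
  by rewrite -mulrA le_eqVlt; apply/orP; left; apply/eqP; ring.
have angle0 : 0 <= disc a b x -> 0 <= 1 + a - b * x -> arc_angle a b x = 0.
  move=> /d0 h1 h2; rewrite ger0_norm// in h1.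
  have u1 : 1 <= (1 + a - b * x) / rho by rewrite ler_pdivlMr// mul1r.
  by rewrite /arc_angle /acos_ext -/rho min_l// max_r ?acos1// ltW.
have anglepi : 0 <= disc a b x -> 1 + a - b * x <= 0 -> arc_angle a b x = pi.
  move=> /d0 h1 h2; rewrite ler0_norm// in h1.
  have u1 : (1 + a - b * x) / rho <= -1 by rewrite ler_pdivrMr// mulN1r; lra.
  by rewrite /arc_angle /acos_ext -/rho min_r ?max_l ?acosN1//; lra.
have mE : 1 + a - b * arc_mid a b = 2 * (a / b).
  by rewrite /arc_mid; field; rewrite lt0r_neq0.
have ab0 : 0 < a / b by rewrite divr_gt0.
have r0 := arc_rad_gt0 a01' b1.
have tp := t_plusE a01 l0; rewrite -/b in tp.
have tm := t_minusE a01 l0; rewrite -/b in tm.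
have lnE : (ln (1 + a) < lambda) = (1 + a < b).
  by rewrite /b -{2}[1 + a]lnK ?ltr_expR// posrE; lra.
case: ifPn => [/andP[/andP[h1 _]]|].
  rewrite lnE => ab.
  have disc0 : 0 <= disc a b x.
    rewrite dE mulr_ge0 ?sqr_ge0// mulr_ge0 ?subr_ge0//.
    by rewrite (le_trans _ h1)// tp tm; lra.
  have N0 : 1 + a - b * x <= 0.
    have : b * t_plus a lambda <= b * x by rewrite ler_pM2l.
    have : 2 * (a / b) <= b * arc_rad a b.
      have q1 : 0 <= 2 * (a / b) by rewrite mulr_ge0// ltW.
      have q2 : 0 <= b * arc_rad a b by rewrite mulr_ge0// ltW.
      rewrite -(@ler_pXn2r _ 2)// [X in _ <= X]exprMn arc_rad_sqr// -subr_ge0.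
      have -> : b ^+ 2 * (4 * ((1 - a / b) * (a * (1 - b^-1))) / b ^+ 2) -
        (2 * (a / b)) ^+ 2 = 4 * (a / b) * (b - (1 + a)) by field; rewrite lt0r_neq0.
      by apply: mulr_ge0; [exact: mulr_ge0 (ltW ab0)|lra].
    rewrite tp mulrDr; lra.
  rewrite anglepi//; move: (pi_gt0 R); generalize (pi : R) => p p0.
  by field; rewrite !lt0r_neq0.
rewrite negb_and lnE -leNgt => h1.
case: ifPn => [_|h2].
  rewrite gt_eqF// [RHS]mulrA -invfM.
  by congr (_^-1 * _); ring.
suff -> : arc_angle a b x = 0 by rewrite !mulr0.
have := h2; rewrite negb_and -!ltNge => /orP[h|h].
  apply: angle0.
    rewrite dE mulr_ge0 ?sqr_ge0// nmulr_rge0 ?subr_lt0// subr_le0.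
    by rewrite (le_trans (ltW h))// tp tm; lra.
  have : b * x <= b * arc_mid a b.
    by rewrite ler_pM2l// (le_trans (ltW h))// tm; lra.
  lra.
apply: angle0.
  rewrite dE mulr_ge0 ?sqr_ge0// mulr_ge0 ?subr_ge0 ?(ltW h)//.
  by rewrite (le_trans _ (ltW h))// tp tm; lra.
case/orP : h1; first by rewrite (ltW h) ltW.
have : b * x < b * 1 by rewrite ltr_pM2l.
lra.
Qed.

End limit_density_theory.

(** * Mass and Cauchy transform of the limit density *)
Section limit_density_integrals.
Context {R : realType}.
Notation mu := (@lebesgue_measure R).
Implicit Types a t lambda x : R.

Lemma log_root0 b t : 0 < b -> 0 < t ->
  log_root 0 b t = ln (1 + b * t) - ln (1 + t) :> R.
Proof.
move=> b0 t0; have bt0 : 0 < b * t by rewrite mulr_gt0.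
rewrite /log_root /disc.
have -> : (1 + 0 - b * - t) ^+ 2 - 4 * 0 * (1 - - t) = (1 + b * t) ^+ 2 by ring.
rewrite sqrtr_sqr ger0_norm; last by lra.
have -> : 1 + 0 + b * t + (1 + b * t) = 2 * (1 + b * t) by ring.
rewrite !lnM ?posrE//; lra.
Qed.

Lemma limit_density0 lambda x : 0 < lambda -> x \in `]0, 1[ ->
  x != expR (- lambda) ->
  limit_density 0 lambda x = if x \in `]expR (- lambda), 1[ then (lambda * x)^-1 else 0.
Proof.
move=> l0; rewrite !in_itv/= => /andP[x0 x1] xN.
have tpE : t_plus 0 lambda = expR (- lambda).
  by rewrite /t_plus !mul0r sqrtr0 subr0 sqrtr1 addr0 expr1n mulr1.
have tmE : t_minus 0 lambda = expR (- lambda).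
  by rewrite /t_minus !mul0r sqrtr0 !subr0 sqrtr1 expr1n mulr1.
rewrite /limit_density tpE tmE addr0 ln1 l0 andbT x1 (ltW x1) !andbT.
rewrite lt_neqAle eq_sym xN /=; case: ifPn => // h; rewrite ifF//.
by apply: contraNF h => /andP[].
Qed.

(** For a = 0 the density is 1 / (lambda x) on [e^(-lambda), 1]; G is a
    primitive of its product with the weight w. *)
Lemma integral_limit_density0 lambda (w G : R -> R) : 0 < lambda ->
  (forall x, 0 < x -> 0 <= w x) ->
  (forall x, 0 < x -> {for x, continuous w}) ->
  (forall x, 0 < x -> is_derive x 1 G ((lambda * x)^-1 * w x)) ->
  (\int[mu]_(x in `]0%R, 1%R[) (limit_density 0 lambda x * w x)%:E =
   (G 1 - G (expR (- lambda)))%:E)%E.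
Proof.
move=> l0 w0 cw dG; set c := expR (- lambda).
have c0 : 0 < c by rewrite expR_gt0.
have c1 : c < 1 by rewrite /c -expR0 ltr_expR oppr_lt0.
transitivity (\int[mu]_(x in `]c, 1%R[) ((lambda * x)^-1 * w x)%:E)%E.
(* at x = c the first case of the density applies, so this point is removed *)
- rewrite -(@integral_setD1 R _ c).
  + rewrite integral_mkcond [RHS]integral_mkcond; apply: eq_integral => x _.
    rewrite !patchE in_setD !mem_setE in_set1.
    have [xI|xI] := boolP (x \in `]0, 1[) => /=; last first.
      rewrite ifF//; apply: contraNF xI; rewrite !in_itv/= => /andP[h ->].
      by rewrite (lt_trans c0 h).
    have [->|xc] /= := eqVneq x c; first by rewrite in_itv/= ltxx.
    by rewrite limit_density0//; case: ifP => // _; rewrite mul0r.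
  + exact: measurableD.
  + apply/measurable_EFinP/measurable_funM.
      apply: measurable_funTS; apply: measurable_limit_density => //.
      by rewrite lexx ler01.
    have mw : measurable_fun (`]0, 1[%classic : set R) w.
      apply: open_continuous_measurable_fun => // x /set_mem /=.
      by rewrite in_itv/= => /andP[? _]; exact: cw.
    by apply: measurable_funS mw => //; exact: subDsetl.
apply: ge0_FTC2_oo => //.
- apply: derivable_within_continuous => x; rewrite in_itv/= => /andP[cx _].
  by have [] := dG x (lt_le_trans c0 cx).
- move=> x; rewrite in_itv/= => /andP[/(lt_trans c0) x0 _].
  have h : lambda * x != 0 by rewrite mulf_neq0 ?lt0r_neq0.
  have ci : {for x, continuous (fun x => (lambda * x)^-1)}.
    apply: (@differentiable_continuous _ R^o R^o); apply/derivable1_diffP.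
    exact: ex_derive.
  by apply: cvgM; [exact: ci|exact: cw].
- by move=> x; rewrite in_itv/= => /andP[/(lt_trans c0) x0 _]; exact: dG.
- move=> x; rewrite in_itv/= => /andP[/(lt_trans c0) x0 _].
  by rewrite mulr_ge0 ?w0// invr_ge0 mulr_ge0// ltW.
Qed.

Lemma integral_limit_density_arc a lambda (w : R -> R) (k : R) : 0 < a <= 1 -> 0 < lambda ->
  measurable_fun setT w -> (forall x, x \in `]0, 1[ -> 0 <= w x) ->
  (\int[mu]_(x in `]0%R, 1%R[) (x^-1 * arc_angle a (expR lambda) x * w x)%:E
    = (pi * k)%:E)%E ->
  (\int[mu]_(x in `]0%R, 1%R[) (limit_density a lambda x * w x)%:E = (lambda^-1 * k)%:E)%E.
Proof.
move=> a01 l0 mw w0 kE.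
have -> : lambda^-1 * k = (lambda * pi)^-1 * (pi * k).
  have := pi_gt0 R; generalize (pi : R) => p p0.
  by field; rewrite !lt0r_neq0.
rewrite EFinM -kE -ge0_integralZl//.
- apply: eq_integral => x /set_mem /=; rewrite in_itv/= => xI.
  by rewrite limit_density_arc_angle// -EFinM !mulrA.
- apply/measurable_EFinP/measurable_funTS/measurable_funM => //.
  by apply: measurable_funM; [exact: measurable_inv|exact: measurable_arc_angle].
- move=> x /= xI; rewrite lee_fin !mulr_ge0 ?acos_ext_ge0 ?w0//.
  by rewrite invr_ge0; move: xI; rewrite in_itv/= => /andP[/ltW].
- by rewrite lee_fin invr_ge0 mulr_ge0 ?pi_ge0 ?ltW.
Qed.

Lemma mass_limit_density a lambda : 0 <= a <= 1 -> 0 < lambda ->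
  (\int[mu]_(x in `]0%R, 1%R[) (limit_density a lambda x)%:E = 1)%E.
Proof.
move=> /andP[a0 a1] l0.
transitivity (\int[mu]_(x in `]0%R, 1%R[) (limit_density a lambda x * 1)%:E)%E.
  by apply: eq_integral => x _; rewrite mulr1.
move: a0; rewrite le_eqVlt => /predU1P[<-|a0].
  have dG x : 0 < x -> is_derive x 1 (fun x => lambda^-1 * ln x) ((lambda * x)^-1 * 1).
    move=> x0; have d := is_derive1_ln x0.
    by apply: is_derive_eq; rewrite mulr1 /GRing.scale /= invfM.
  rewrite (integral_limit_density0 l0 _ _ dG)//.
    by rewrite ln1 mulr0 sub0r expRK mulrN opprK mulVf ?lt0r_neq0.
  by move=> x _; exact: cst_continuous.
have a01 : 0 < a <= 1 by rewrite a0.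
rewrite (@integral_limit_density_arc a _ (fun=> 1) lambda) ?mulVf ?lt0r_neq0//.
under eq_integral do rewrite mulr1.
by rewrite mass_arc_angle ?expR_gt1// expRK.
Qed.

Lemma cauchy_limit_density a lambda t : 0 <= a <= 1 -> 0 < lambda -> 0 < t ->
  (\int[mu]_(x in `]0%R, 1%R[) (limit_density a lambda x * (t / (t + x)))%:E =
   (lambda^-1 * log_root a (expR lambda) t)%:E)%E.
Proof.
move=> /andP[a0 a1] l0 t0.
have w0 x : 0 < x -> 0 <= t / (t + x).
  by move=> x0; rewrite divr_ge0 ?addr_ge0 ?ltW.
move: a0; rewrite le_eqVlt => /predU1P[<-|a0].
  have dG x : 0 < x -> is_derive x 1 (fun x => lambda^-1 * (ln x - ln (t + x)))
      ((lambda * x)^-1 * (t / (t + x))).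
    move=> x0; have tx0 : 0 < t + x by rewrite addr_gt0.
    have d1 := is_derive1_ln x0.
    have d2 : is_derive x 1 (fun x => t + x) 1.
      by apply: is_derive_eq; rewrite add0r mulr1.
    have d3 := @is_derive1_comp R (@ln R) _ x _ _ (is_derive1_ln tx0) d2.
    apply: (is_derive_eq (is_deriveZ lambda^-1 (is_deriveB d1 d3))).
    by rewrite /GRing.scale /=; field; rewrite !lt0r_neq0.
  rewrite (integral_limit_density0 l0 w0 _ dG)//.
    rewrite log_root0 ?expR_gt0// -mulrBr; congr (_ * _)%:E.
    have -> : 1 + expR lambda * t = expR lambda * (t + expR (- lambda)).
      by rewrite mulrDr -expRD subrr expR0 addrC.
    rewrite lnM ?posrE ?expR_gt0// ?addr_gt0 ?expR_gt0// !expRK ln1 (addrC t 1).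
    by ring.
  move=> x x0; apply: (@differentiable_continuous _ R^o R^o).
  apply/derivable1_diffP.
  have h : t + x != 0 by rewrite lt0r_neq0 ?addr_gt0.
  exact: ex_derive.
have a01 : 0 < a <= 1 by rewrite a0.
apply: integral_limit_density_arc => //.
- apply: measurable_funM => //; apply: (measurableT_comp (@measurable_inv R)).
  exact: measurable_funD.
- by move=> x; rewrite in_itv/= => /andP[/w0].
- by rewrite cauchy_arc_angle ?expR_gt1.
Qed.

End limit_density_integrals.

(** * The limit measure *)
Section probability_with_density.
Context {R : realType}.
Notation leb := (@lebesgue_measure R).
Variable p : measurableTypeR R -> R.
Hypotheses (mp : measurable_fun setT p) (p0 : forall x, 0 <= p x)
  (p1 : (\int[leb]_x (p x)%:E = 1)%E).

(** The hypotheses are arguments, so that the structure of probability measure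
    can be attached to the function itself. *)
Definition density_prob of measurable_fun setT p & (forall x, 0 <= p x) &
    (\int[leb]_x (p x)%:E = 1)%E :=
  fun A : set (measurableTypeR R) => (\int[leb]_(x in A) (p x)%:E)%E.

Local Notation nu := (density_prob mp p0 p1).

Let nu0 : nu set0 = 0%E.
Proof. exact: integral_set0. Qed.

Let nu_ge0 A : (0 <= nu A)%E.
Proof. by apply: integral_ge0 => x _; rewrite lee_fin. Qed.

Let nu_sigma_additive : semi_sigma_additive nu.
Proof.
move=> /= F mF tF mUF; rewrite /density_prob; apply: cvg_toP.
  apply: ereal_nondecreasing_is_cvgn => m n mn.
  apply: lee_sum_nneg_natr => // k _ _; exact: nu_ge0.
rewrite ge0_integral_bigcup//=.
- exact/measurable_funTS/measurable_EFinP.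
- by move=> x _; rewrite lee_fin.
Qed.

HB.instance Definition _ := isMeasure.Build _ _ _ nu
  nu0 nu_ge0 nu_sigma_additive.

Let nu_setT : nu setT = 1%E. Proof. exact: p1. Qed.

HB.instance Definition _ := Measure_isProbability.Build _ _ R nu nu_setT.

(** By uniqueness, the Radon-Nikodym derivative is p almost everywhere. *)
Lemma ge0_integral_density (g : measurableTypeR R -> \bar R) :
  measurable_fun setT g -> (forall x, (0 <= g x)%E) ->
  (\int[nu]_x g x = \int[leb]_x (g x * (p x)%:E))%E.
Proof.
move=> mg g0.
have nuleb : nu `<< leb.
  apply/null_content_dominatesP => A mA A0; rewrite /= /density_prob.
  by apply: null_set_integral => //; exact/measurable_funTS/measurable_EFinP.
rewrite -(Radon_Nikodym_SigmaFinite.change_of_variables nuleb)//.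
have intf := Radon_Nikodym_SigmaFinite.f_integrable nuleb.
apply: ae_eq_integral => //.
- by apply: emeasurable_funM => //; exact: measurable_int intf.
- by apply: emeasurable_funM => //; exact/measurable_EFinP.
- apply: ae_eqe_mul2l; apply: integral_ae_eq => //; first exact/measurable_EFinP.
  by move=> E _ mE; rewrite -Radon_Nikodym_SigmaFinite.f_integral.
Qed.

End probability_with_density.

Section limit_measure.
Context {R : realType}.
Notation leb := (@lebesgue_measure R).
Implicit Types a t lambda x : R.

Lemma integral_limit_density_setT a lambda (g : R -> R) : 0 <= a <= 1 -> 0 < lambda ->
  measurable_fun setT g ->
  (\int[leb]_x (g x * limit_density a lambda x)%:E =
   \int[leb]_(x in `]0%R, 1%R[) (limit_density a lambda x * g x)%:E)%E.
Proof.
move=> a01 l0 mg.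
rewrite -(@integral_itv_bndoo _ _ _ _ true false); last first.
  apply/measurable_EFinP/measurable_funM; last exact: measurable_funTS.
  by apply: measurable_funTS; exact: measurable_limit_density.
rewrite [RHS]integral_mkcond; apply: eq_integral => x _.
rewrite patchE mem_setE; case: ifPn => x01; first by rewrite mulrC.
by rewrite limit_density_out// mulr0.
Qed.

Lemma total_mass_limit_density a lambda : 0 <= a <= 1 -> 0 < lambda ->
  (\int[leb]_x (limit_density a lambda x)%:E = 1)%E.
Proof.
move=> a01 l0; have := @integral_limit_density_setT a lambda (fun=> 1) a01 l0.
under eq_integral do rewrite mul1r.
move=> ->//; under eq_integral do rewrite mulr1.
exact: mass_limit_density.
Qed.

Lemma limit_measure_ex a lambda : 0 <= a <= 1 -> 0 < lambda ->
  exists mu : probability (measurableTypeR R) R,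
  [/\ has_density mu (limit_density a lambda),
      mu `[0, 1]%classic = 1%E &
      forall t, 0 < t ->
        (\int[mu]_(x in `[0%R, 1%R]) (t / (t + x))%:E =
         (lambda^-1 * log_root a (expR lambda) t)%:E)%E].
Proof.
move=> a01 l0.
have mp := measurable_limit_density a01 l0.
have p0 x := limit_density_ge0 x a01 l0.
have p1 := total_mass_limit_density a01 l0.
exists (density_prob mp p0 p1); split => //.
- rewrite /= /density_prob integral_itv_bndoo; first exact: mass_limit_density.
  exact/measurable_EFinP/measurable_funTS.
- move=> t t0.
  have mw : measurable_fun setT (fun x => \1_`[0, 1]%classic x * (t / (t + x))).
    apply: measurable_funM => //.
    apply: measurable_funM => //; apply: (measurableT_comp (@measurable_inv R)).
    exact: measurable_funD.
  transitivity (\int[density_prob mp p0 p1]_x (\1_`[0, 1]%classic x * (t / (t + x)))%:E)%E.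
    rewrite integral_mkcond; apply: eq_integral => x _.
    by rewrite patchE indicE; case: ifPn; rewrite ?mul1r ?mul0r.
  rewrite ge0_integral_density//.
  + under eq_integral do rewrite -EFinM.
    rewrite integral_limit_density_setT// -cauchy_limit_density//.
    apply: eq_integral => x /set_mem /= x01; rewrite indicE mem_set ?mul1r//.
    exact: subset_itv_oo_cc.
  + exact/measurable_EFinP.
  + move=> x; rewrite lee_fin indicE; have [xI|] := boolP (_ \in _); last by rewrite mul0r.
    move: xI; rewrite mem_setE in_itv/= => /andP[x0 _].
    by rewrite mul1r divr_ge0 ?addr_ge0// ltW.
Qed.

End limit_measure.

(** * Limit of the Cauchy transforms of the zeros *)
Section logarithmic_derivative_of_zeros.
Context {R : realType}.
Implicit Types a b t q z x : R.

Lemma ln_le_subr1 x : 0 < x -> ln x <= x - 1.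
Proof.
move=> x0; rewrite -ler_expR lnK ?posrE//.
by have := expR_ge1Dx (x - 1); rewrite addrCA subrr addr0.
Qed.

Lemma ln_ge_subr1 x : 0 < x -> 1 - x^-1 <= ln x.
Proof.
move=> x0; have xV0 : 0 < x^-1 by rewrite invr_gt0.
by have := ln_le_subr1 xV0; rewrite lnV ?posrE//; lra.
Qed.

Lemma dist_expR_le u v : u <= 0 -> v <= 0 -> `|expR u - expR v| <= `|u - v| :> R.
Proof.
wlog uv : u v / u <= v => [H|_ v0].
  have [uv|/ltW vu] := leP u v; first exact: H.
  by move=> u0 v0; rewrite distrC (distrC u); exact: H.
rewrite distrC (distrC u) !ger0_norm ?subr_ge0 ?ler_expR//.
have -> : expR u = expR v * expR (u - v) by rewrite -expRD addrC subrK.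
have h1 := expR_ge1Dx (u - v); have h2 := expR_gt0 v.
have h3 : expR v <= 1 by rewrite -expR0 ler_expR.
have -> : expR v - expR v * expR (u - v) = expR v * (1 - expR (u - v)) by ring.
apply: (@le_trans _ _ (expR v * (v - u))); first by rewrite ler_pM2l//; lra.
by rewrite ler_piMl// subr_ge0.
Qed.

(** With n zeros z this is n S_n(t), that is, t times the logarithmic derivative
    at t of the polynomial with zeros -z. *)
Definition sum_frac (s : seq R) t : R := \sum_(z <- s) t / (t + z).

Lemma sum_frac_bounds (s : seq R) t : all (fun z => 0 < z) s -> 0 < t ->
  0 <= sum_frac s t <= (size s)%:R.
Proof.
move=> /allP s0 t0; rewrite /sum_frac !big_seq; apply/andP; split.
  by apply: sumr_ge0 => z /s0 z0; rewrite divr_ge0 ?addr_ge0 ?ltW.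
rewrite -big_seq -sum1_size natr_sum !big_seq; apply: ler_sum => z /s0 z0.
by rewrite ler_pdivrMr ?addr_gt0// mul1r lerDl ltW.
Qed.

Lemma sum_frac_dilate (s : seq R) t q : all (fun z => 0 < z) s -> 0 < t -> 0 < q <= 1 ->
  q * sum_frac s t <= sum_frac s (q * t) <= sum_frac s t.
Proof.
move=> /allP s0 t0 /andP[q0 q1]; have qt0 : 0 < q * t by rewrite mulr_gt0.
have qt : q * t <= t by rewrite ler_piMl// ltW.
rewrite /sum_frac mulr_sumr !big_seq; apply/andP; split; apply: ler_sum => z /s0 z0.
  by rewrite mulrA ler_pM2l// lef_pV2 ?posrE ?addr_gt0// lerD2r.
rewrite ler_pdivrMr ?addr_gt0// mulrAC ler_pdivlMr ?addr_gt0//.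
by rewrite !mulrDr (mulrC t) lerD2l ler_pM2r.
Qed.

Definition log_ratio (s : seq R) q t : R := \sum_(z <- s) ln ((q * t + z) / (t + z)).

(** Each ratio is 1 - (1 - q) theta with theta = t / (t + z), and
    1 - 1/w <= ln w <= w - 1. *)
Lemma log_ratio_bounds (s : seq R) t q : all (fun z => 0 < z) s -> 0 < t -> 0 < q < 1 ->
  - ((q^-1 - 1) * sum_frac s t) <= log_ratio s q t <= - ((1 - q) * sum_frac s t).
Proof.
move=> /allP s0 t0 /andP[q0 q1]; rewrite /log_ratio /sum_frac !mulr_sumr -!sumrN !big_seq.
apply/andP; split; apply: ler_sum => z /s0 z0; have tz0 : 0 < t + z by rewrite addr_gt0.
all: have w0 : 0 < (q * t + z) / (t + z) by rewrite divr_gt0 ?addr_gt0 ?mulr_gt0.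
  apply: le_trans (ln_ge_subr1 w0); rewrite invf_div.
  have h0 : 0 < q * t + z by rewrite addr_gt0 ?mulr_gt0.
  have -> : 1 - (t + z) / (q * t + z) = - ((1 - q) * t / (q * t + z)).
    by field; rewrite lt0r_neq0.
  rewrite lerN2 ler_pdivrMr//.
  have -> : (q^-1 - 1) * (t / (t + z)) * (q * t + z) =
      (1 - q) * t * ((t + q^-1 * z) / (t + z)).
    by field; rewrite !lt0r_neq0.
  rewrite ler_peMr ?mulr_ge0 ?subr_ge0 ?(ltW q1) ?(ltW t0)//.
  rewrite ler_pdivlMr// mul1r lerD2l ler_peMl ?(ltW z0)//.
  by rewrite invf_ge1 ?ltW.
apply: le_trans (ln_le_subr1 w0) _; rewrite le_eqVlt; apply/orP; left; apply/eqP.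
by field; rewrite lt0r_neq0.
Qed.

Lemma horner_dilate (s : seq R) (c : R) q t : all (fun z => 0 < z) s -> 0 < t -> 0 < q ->
  let p := c *: \prod_(z <- s) ('X - z%:P) in
  p.[- (q * t)] = p.[- t] * expR (log_ratio s q t).
Proof.
move=> /allP s0 t0 q0 p; rewrite /p !hornerZ -mulrA; congr (_ * _).
rewrite /log_ratio !horner_prod; elim: s s0 {p} => [|z s IH] s0.
  by rewrite !big_nil expR0 mulr1.
rewrite !big_cons expRD IH; last by move=> w ws; apply: s0; rewrite inE ws orbT.
have z0 : 0 < z by apply: s0; rewrite inE eqxx.
have tz0 : 0 < t + z by rewrite addr_gt0.
rewrite lnK ?posrE; last by rewrite divr_gt0 ?addr_gt0 ?mulr_gt0.
by rewrite !hornerXsubC; field; rewrite lt0r_neq0.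
Qed.

Lemma horner_opp_neq0 (s : seq R) (c : R) t : all (fun z => 0 < z) s -> 0 < t -> c != 0 ->
  (c *: \prod_(z <- s) ('X - z%:P)).[- t] != 0.
Proof.
move=> /allP s0 t0 c0; rewrite -/(root _ _) rootZ// root_prod_XsubC.
by apply/negP => /s0; rewrite oppr_gt0 ltNge ltW.
Qed.

(** The smaller root of the quadratic equation, of which log_root is the
    opposite of the logarithm. *)
Definition log_root_exp a b t : R :=
  2 * (1 + t) / (1 + a + b * t + Num.sqrt (disc a b (- t))).

Section quadratic_root.
Variables a b t : R.
Hypotheses (a01 : 0 <= a <= 1) (b1 : 1 <= b) (t0 : 0 < t).

Let s := 1 + a + b * t.
Let D := disc a b (- t).

Let s_ge : 1 + a + t <= s.
Proof. by rewrite /s lerD2l ler_peMl// ltW. Qed.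

Let sqrtD_ge : 1 + t - a <= Num.sqrt D.
Proof.
have a1 : a <= 1 by case/andP: a01.
rewrite -[1 + t - a]ger0_norm; last by move: t0; lra.
rewrite -sqrtr_sqr ler_wsqrtr// /D /disc; have := s_ge; rewrite /s.
have a0 : 0 <= a by case/andP: a01.
move: a0 a1 t0; set w := b * t => a0 a1 t0' h.
rewrite mulrN !opprK -/w -subr_ge0.
have -> : (1 + a + w) ^+ 2 - 4 * a * (1 + t) - (1 + t - a) ^+ 2 =
  (w - t) * (2 + 2 * a + w + t) by ring.
by rewrite mulr_ge0; lra.
Qed.

Let sD_gt0 : 0 < s + Num.sqrt D.
Proof.
have h1 := s_ge; have h2 := sqrtr_ge0 D; case/andP: a01 => a0 a1.
by move: t0; lra.
Qed.

Lemma log_rootE : log_root a b t = - ln (log_root_exp a b t).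
Proof.
rewrite /log_root /log_root_exp -/D -/s ln_div ?posrE//; first by ring.
by rewrite mulr_gt0// addr_gt0.
Qed.

Lemma log_root_exp_gt0 : 0 < log_root_exp a b t.
Proof. by rewrite /log_root_exp divr_gt0// mulr_gt0// addr_gt0. Qed.

Lemma log_root_exp_le1 : log_root_exp a b t <= 1.
Proof.
rewrite /log_root_exp -/s -/D ler_pdivrMr// mul1r.
by have h1 := s_ge; have h2 := sqrtD_ge; move: h1 h2 t0; lra.
Qed.

Lemma log_root_exp_quad (y : R) :
  (1 + t) - s * y + a * y ^+ 2 =
  (y - log_root_exp a b t) * (a * (y + log_root_exp a b t) - s).
Proof.
set r := log_root_exp a b t.
(* r is a root; the factorization follows by subtraction *)
have rE : (1 + t) - s * r + a * r ^+ 2 = 0.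
  have DE : Num.sqrt D ^+ 2 = s ^+ 2 - 4 * a * (1 + t).
    by rewrite sqr_sqrtr ?ltW ?disc_opp_gt0// /D /disc /s mulrN !opprK.
  rewrite /r /log_root_exp -/s -/D; move: DE sD_gt0; set S := Num.sqrt D => DE sS.
  apply/eqP; rewrite -(mulIr_eq0 _ (mulIf (lt0r_neq0 (exprn_gt0 2 sS)))).
  have -> : (1 + t - s * (2 * (1 + t) / (s + S)) + a * (2 * (1 + t) / (s + S)) ^+ 2) *
     (s + S) ^+ 2 = (1 + t) * (S ^+ 2 - (s ^+ 2 - 4 * a * (1 + t))).
    by field; rewrite lt0r_neq0.
  by rewrite DE subrr mulr0.
have -> : (1 + t) - s * y + a * y ^+ 2 =
  (1 + t) - s * y + a * y ^+ 2 - ((1 + t) - s * r + a * r ^+ 2) by rewrite rE subr0.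
by ring.
Qed.

(** At y <= 1 the other factor of the quadratic polynomial is at least b t in
    absolute value, so an approximate root is close to the root. *)
Lemma quad_root_dist (y e : R) : y <= 1 ->
  `|(1 + t) - s * y + a * y ^+ 2| <= e -> `|y - log_root_exp a b t| <= e / (b * t).
Proof.
move=> y1; rewrite log_root_exp_quad normrM => h.
have bt0 : 0 < b * t by rewrite mulr_gt0//; move: b1; lra.
rewrite ler_pdivlMr//; apply: le_trans h; rewrite ler_wpM2l//.
have r1 := log_root_exp_le1; case/andP: a01 => a0 a1.
rewrite distrC ler_normr; apply/orP; left.
have : a * (y + log_root_exp a b t) <= a * 2 by rewrite ler_wpM2l//; lra.
rewrite /s; lra.
Qed.

End quadratic_root.

Section zeros_estimate.
Variables (lambda a t : R) (n : nat) (s : seq R).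
Hypotheses (l0 : 0 < lambda) (a01 : 0 <= a <= 1) (t0 : 0 < t).
Let x := lambda / n%:R.
Let q := expR (- x).
Hypotheses (n0 : (0 < n)%N) (x2 : x <= 1 / 2) (sn : size s = n)
  (s0 : all (fun z => 0 < z) s)
  (sE : little_qLaguerre n a q =
     lead_coef (little_qLaguerre n a q) *: \prod_(z <- s) ('X - z%:P)).

Let nR0 : (0 : R) < n%:R. Proof. by rewrite ltr0n. Qed.
Let x0 : 0 < x. Proof. by rewrite divr_gt0. Qed.
Let q01 : 0 < q < 1.
Proof. by rewrite expR_gt0 /q -expR0 ltr_expR oppr_lt0 x0. Qed.
Let q0 : 0 < q. Proof. by case/andP: q01. Qed.
Let q1 : q < 1. Proof. by case/andP: q01. Qed.
Let A := n%:R^-1 * sum_frac s t.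
Let b := expR lambda.

Let A01 : 0 <= A <= 1.
Proof.
have /andP[h1 h2] := sum_frac_bounds s0 t0; rewrite sn in h2.
by rewrite /A mulr_ge0 ?invr_ge0 ?(ltW nR0)//= mulrC ler_pdivrMr// mul1r.
Qed.

Let q_ge : 1 - q <= x.
Proof. have := expR_ge1Dx (- x); rewrite -/q; lra. Qed.

Let q_le : x / (1 + x) <= 1 - q.
Proof.
have h := expR_ge1Dx x; have h1 : 0 < 1 + x by move: x0; lra.
have : q <= (1 + x)^-1 by rewrite /q expRN lef_pV2 ?posrE ?expR_gt0.
have -> : x / (1 + x) = 1 - (1 + x)^-1 by field; rewrite lt0r_neq0.
lra.
Qed.

Let qV_ge : q^-1 - 1 <= x / (1 - x).
Proof.
have h := expR_ge1Dx (- x); rewrite -/q in h; have h1 : 0 < 1 - x by move: x2; lra.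
have : q^-1 <= (1 - x)^-1 by rewrite lef_pV2 ?posrE.
have -> : x / (1 - x) = (1 - x)^-1 - 1 by field; rewrite lt0r_neq0.
lra.
Qed.

Let log_ratio_sum_frac u : 0 < u ->
  `|log_ratio s q u + x * sum_frac s u| <= 3 * lambda * x.
Proof.
move=> u0; have /andP[h1 h2] := log_ratio_bounds s0 u0 q01.
have /andP[T0 Tn] := sum_frac_bounds s0 u0; rewrite sn in Tn.
set T := sum_frac s u in h1 h2 T0 Tn *.
have xT : x * T <= lambda.
  by rewrite /x -mulrA mulrC -[leRHS]mul1r ler_wpM2r ?(ltW l0)// mulrC ler_pdivrMr// mul1r.
have xT0 : 0 <= x * T by rewrite mulr_ge0// ltW.
have e1 : (q^-1 - 1) * T <= x * T + 2 * lambda * x.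
  apply: (@le_trans _ _ (x / (1 - x) * T)); first by rewrite ler_wpM2r.
  have h : 0 < 1 - x by move: x2; lra.
  rewrite mulrAC ler_pdivrMr//.
  have : lambda * x * (1 - 2 * x) >= 0.
    by rewrite mulr_ge0 ?mulr_ge0 ?(ltW l0) ?(ltW x0)//; move: x2; lra.
  have : x * T * x <= lambda * x by rewrite ler_wpM2r// ltW.
  by move: x2; lra.
have e2 : x * T - lambda * x <= (1 - q) * T.
  apply: (@le_trans _ _ (x / (1 + x) * T)); last by rewrite ler_wpM2r.
  have h : 0 < 1 + x by move: x0; lra.
  rewrite [leRHS]mulrAC ler_pdivlMr//.
  have : x * T * x <= lambda * x by rewrite ler_wpM2r// ltW.
  have : 0 <= lambda * x * x by rewrite !mulr_ge0 ?(ltW l0) ?(ltW x0).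
  lra.
have lx : 0 <= lambda * x by rewrite mulr_ge0 ?(ltW l0) ?(ltW x0).
by rewrite ler_norml; lra.
Qed.

Let xTA : x * sum_frac s t = lambda * A.
Proof. by rewrite /x /A; ring. Qed.

Let ratio1 : `|log_ratio s q t + lambda * A| <= 4 * lambda * x.
Proof.
rewrite -xTA (le_trans (log_ratio_sum_frac t0))//.
have lx : 0 <= lambda * x by rewrite mulr_ge0 ?(ltW l0) ?(ltW x0).
lra.
Qed.

Let ratio2 : `|log_ratio s q (q * t) + lambda * A| <= 4 * lambda * x.
Proof.
have qt0 : 0 < q * t by rewrite mulr_gt0.
have h := log_ratio_sum_frac qt0.
have q01' : 0 < q <= 1 by rewrite q0 ltW.
have /andP[h1 h2] := sum_frac_dilate s0 t0 q01'.
have h3 : x * (q * sum_frac s t) <= x * sum_frac s (q * t) by rewrite ler_pM2l.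
have h4 : x * sum_frac s (q * t) <= x * sum_frac s t by rewrite ler_pM2l.
rewrite xTA in h4; rewrite mulrCA xTA in h3.
have h5 : lambda * A * (1 - q) <= lambda * x.
  case/andP: A01 => A0 A1; rewrite -mulrA ler_pM2l//.
  apply: le_trans q_ge; rewrite ler_piMl//; move: q1; lra.
by move: h; rewrite !ler_norml; lra.
Qed.

Let log_ratio_le0 u : 0 < u -> log_ratio s q u <= 0.
Proof.
move=> u0; have /andP[_ h2] := log_ratio_bounds s0 u0 q01.
have /andP[T0 _] := sum_frac_bounds s0 u0.
by rewrite (le_trans h2)// oppr_le0 mulr_ge0// subr_ge0 ltW.
Qed.

(** In the q-difference equation the two ratios P_n(-qt)/P_n(-t) and
    P_n(-q^2 t)/P_n(-qt) are replaced by exp(- lambda A), where A = S_n(t); the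
    error is of order x = lambda / n, and quad_root_dist applies. *)
Lemma zeros_estimate : `|expR (- (lambda * A)) - log_root_exp a b t| <=
  (t + b * t + (1 + a + b * t) * (4 * lambda) + 8 * lambda * a) * x / (b * t).
Proof.
have b1 : 1 <= b by rewrite /b -expR0 ler_expR ltW.
have qt0 : 0 < q * t by rewrite mulr_gt0.
have lA0 : 0 <= lambda * A by rewrite mulr_ge0 ?(ltW l0)//; case/andP: A01.
apply: quad_root_dist => //; first by rewrite -expR0 ler_expR oppr_le0.
have sE' := sE; set Y := expR _; set c := lead_coef (little_qLaguerre n a q) in sE'.
have c0 : c != 0.
  by rewrite lead_coef_eq0 -size_poly_eq0 size_little_qLaguerre.
have := little_qLaguerre_qdiff q01 n t a01.
have bE : q^-n = b.
  by rewrite /q -expRM_natr -expRN mulNr opprK /x divfK// lt0r_neq0.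
rewrite /= bE sE' !horner_dilate//.
set y := (_ *: _).[- t]; set l1 := log_ratio s q t; set l2 := log_ratio s q (q * t).
have y0 : y != 0 by exact: horner_opp_neq0.
have -> : (1 + q * t) * y - (1 + a + q * b * t) * (y * expR l1) +
    a * (y * expR l1 * expR l2) =
    y * ((1 + q * t) - (1 + a + q * b * t) * expR l1 + a * expR (l1 + l2)).
  by rewrite expRD; ring.
move/eqP; rewrite mulf_eq0 (negPf y0) /= => /eqP E0.
have d1 : `|expR l1 - Y| <= 4 * lambda * x.
  apply: le_trans (dist_expR_le _ _) _; [exact: log_ratio_le0|by rewrite oppr_le0|].
  by rewrite opprK.
have Y2 : Y ^+ 2 = expR (- (lambda * A) - lambda * A) by rewrite expRD expr2.
have d2 : `|expR (l1 + l2) - Y ^+ 2| <= 8 * lambda * x.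
  rewrite Y2; apply: le_trans (dist_expR_le _ _) _.
  - by have := log_ratio_le0 t0; have := log_ratio_le0 qt0; rewrite -/l1 -/l2; lra.
  - lra.
  - by move: ratio1 ratio2; rewrite -/l1 -/l2 !ler_norml; lra.
have e0 : expR l1 <= 1 by rewrite -expR0 ler_expR log_ratio_le0.
have e00 := expR_gt0 l1.
have E1 : `|(1 - q) * t| <= x * t.
  by rewrite ger0_norm ?ler_pM2r// mulr_ge0 ?subr_ge0 ?(ltW q1) ?(ltW t0).
have bt0 : 0 < b * t by rewrite mulr_gt0//; move: b1; lra.
have E2 : `|(1 - q) * (b * t) * expR l1| <= x * (b * t).
  have h : 0 <= (1 - q) * (b * t).
    by apply: mulr_ge0; [rewrite subr_ge0; exact: ltW|exact: ltW].
  rewrite ger0_norm; last by apply: mulr_ge0 => //; exact: ltW.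
  by apply: (@le_trans _ _ ((1 - q) * (b * t))); rewrite ?ler_piMr// ler_pM2r.
have E3 : `|(1 + a + b * t) * (expR l1 - Y)| <= (1 + a + b * t) * (4 * lambda * x).
  have h : 0 <= 1 + a + b * t.
    have a0 : 0 <= a by case/andP: a01.
    by apply: addr_ge0; [apply: addr_ge0|exact: ltW].
  by rewrite normrM ger0_norm// ler_wpM2l.
have E4 : `|a * (expR (l1 + l2) - Y ^+ 2)| <= a * (8 * lambda * x).
  case/andP: a01 => a0 _; by rewrite normrM ger0_norm// ler_wpM2l.
(* subtract the q-difference equation E0 from the quadratic polynomial at Y *)
have -> : 1 + t - (1 + a + b * t) * Y + a * Y ^+ 2 = (1 - q) * t
  - (1 - q) * (b * t) * expR l1 + (1 + a + b * t) * (expR l1 - Y)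
  - a * (expR (l1 + l2) - Y ^+ 2) +
  ((1 + q * t) - (1 + a + q * b * t) * expR l1 + a * expR (l1 + l2)) by ring.
rewrite E0 addr0.
move: E1 E2 E3 E4; rewrite !ler_norml; lra.
Qed.

End zeros_estimate.

Lemma cvg_sum_frac lambda a t (s : nat -> seq R) : 0 < lambda -> 0 <= a <= 1 -> 0 < t ->
  (forall n, (0 < n)%N -> let q := expR (- (lambda / n%:R)) in
    [/\ size (s n) = n, all (fun z => 0 < z) (s n) &
      little_qLaguerre n a q =
        lead_coef (little_qLaguerre n a q) *: \prod_(z <- s n) ('X - z%:P)]) ->
  n%:R^-1 * sum_frac (s n) t @[n --> \oo] --> lambda^-1 * log_root a (expR lambda) t.
Proof.
move=> l0 a01 t0 sP.
have b1 : 1 <= expR lambda by rewrite -expR0 ler_expR ltW.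
set b := expR lambda in b1 *.
have r0 := log_root_exp_gt0 a01 b1 t0.
pose K := (t + b * t + (1 + a + b * t) * (4 * lambda) + 8 * lambda * a) * lambda / (b * t).
have Y_cvg : expR (- (lambda * (n%:R^-1 * sum_frac (s n) t))) @[n --> \oo] -->
    log_root_exp a b t.
  apply/(@cvgrPdist_le _ R^o) => e e0; near=> n.
  have n0 : (0 < n)%N by near: n; exists 1%N.
  have nR0 : (0 : R) < n%:R by rewrite ltr0n.
  have [sn sn0 sE] := sP n n0.
  rewrite distrC; apply: le_trans (zeros_estimate l0 a01 t0 n0 _ sn sn0 sE) _.
    rewrite ler_pdivrMr//.
    have : 2 * lambda <= n%:R by near: n; exact: nbhs_infty_ger.
    lra.
  rewrite -/b (_ : _ * (lambda / n%:R) / _ = K / n%:R); last by rewrite /K; ring.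
  rewrite ler_pdivrMr// mulrC -ler_pdivrMr//.
  by near: n; exact: nbhs_infty_ger.
rewrite log_rootE//.
have -> : (fun n => n%:R^-1 * sum_frac (s n) t) =
  (fun n => lambda^-1 * - ln (expR (- (lambda * (n%:R^-1 * sum_frac (s n) t))))).
  by apply/funext => n; rewrite expRK opprK mulKf// lt0r_neq0.
apply: cvgMr; apply: cvgN.
by apply: continuous_cvg; [exact: continuous_ln|exact: Y_cvg].
Unshelve. all: by end_near. Qed.

End logarithmic_derivative_of_zeros.

(** * Integrals on the Riemann sphere *)
Section integrals_on_the_sphere.
Context {R : realType}.

Lemma continuous_borel_measurable (f : sphere R -> R) : continuous f ->
  measurable_fun [set: borel (sphere R)] (f : borel (sphere R) -> R).
Proof.
move=> cf; apply: (measurability _ (RGenOInfty.measurableE R)) => _ [_ [x ->] <-].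
rewrite setTI; apply: sub_sigma_algebra.
apply: (@open_comp (sphere R) R f) => //; exact: interval_open.
Qed.

Lemma ge0_integral_empirical_zeros n (p : {poly R[i]}) (f : sphere R -> R) :
  (size p).-1 = n -> measurable_fun [set: borel (sphere R)] (f : borel (sphere R) -> R) ->
  (forall z, 0 <= f z) ->
  (\int[empirical_zeros n p]_z (f z)%:E =
   (n%:R^-1 * \sum_(z <- zeros p) f (Some z))%:E)%E.
Proof.
move=> pn mf f0.
have mf' : measurable_fun [set: borel (sphere R)] (EFin \o f) by exact/measurable_EFinP.
have f0' (z : borel (sphere R)) : setT z -> (0 <= (EFin \o f) z)%E.
  by move=> _; rewrite lee_fin.
rewrite /empirical_zeros ge0_integral_mscale// ge0_integral_measure_add//.
rewrite ge0_integral_mscale// pn subnn mul0e adde0 EFinM; congr (_ * _)%E.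
rewrite /zeros_msum ge0_integral_measure_sum//.
rewrite (big_nth 0) big_mkord -sumEFin; apply: eq_bigr => i _.
by rewrite integral_dirac//= diracT mul1e.
Qed.

(** When the degree of p is n, there is no mass at infinity. *)
Lemma integral_empirical_zeros n (p : {poly R[i]}) (f : sphere R -> R) :
  (size p).-1 = n -> continuous f ->
  (\int[empirical_zeros n p]_z (f z)%:E =
   (n%:R^-1 * \sum_(z <- zeros p) f (Some z))%:E)%E.
Proof.
move=> pn /continuous_borel_measurable mf.
rewrite integralE.
have -> : (fun z => (f z)%:E)^\+%E = (fun z => (Num.max (f z) 0)%:E).
  by apply/funext => z; rewrite funeposE EFin_max.
have -> : (fun z => (f z)%:E)^\-%E = (fun z => (Num.max (- f z) 0)%:E).
  by apply/funext => z; rewrite funenegE EFin_max.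
rewrite !ge0_integral_empirical_zeros//.
- rewrite -EFinB -mulrBr -sumrB; congr (_ * _)%:E; apply: eq_bigr => z _.
  by have [|] := leP (f (Some z)) 0; have [|] := leP (- f (Some z)) 0; lra.
- by apply: measurable_maxr => //; exact: (measurableT_comp (@oppr_measurable R setT)).
- by move=> z; rewrite le_max lexx orbT.
- exact: measurable_maxr.
- by move=> z; rewrite le_max lexx orbT.
Qed.

(** The complement of D is a null set, where the integrand may be replaced
    by 0. *)
Lemma integral_on_full_set d (T : measurableType d) (mu : probability T R) (D : set T)
    (f : T -> R) :
  measurable D -> mu D = 1%E -> measurable_fun setT f ->
  (\int[mu]_x (f x)%:E = \int[mu]_(x in D) (f x)%:E)%E.
Proof.
move=> mD D1 mf; rewrite [RHS]integral_mkcond; apply: ae_eq_integral => //.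
- exact/measurable_EFinP.
- by apply/(measurable_restrictT _ mD)/measurable_funTS/measurable_EFinP.
- exists (~` D); split; first exact: measurableC.
    by have := probability_setC mu mD; rewrite D1 subee.
  move=> x /= h Dx; apply: h => _; by rewrite patchE mem_set.
Qed.

Lemma bounded_integrable d (T : measurableType d) (mu : probability T R)
    (f : T -> R) (M : R) :
  measurable_fun setT f -> (forall x, `|f x| <= M) ->
  mu.-integrable setT (EFin \o f).
Proof.
move=> mf fM; apply: measurable_bounded_integrable => //.
  by rewrite (le_lt_trans (probability_le1 _ _))// ltry.
exists M; split; first exact: num_real.
by move=> N MN x _ /=; exact: le_trans (fM x) (ltW MN).
Qed.

Variable mu : probability (measurableTypeR R) R.
Hypothesis mu01 : mu `[0, 1]%classic = 1%E.

Lemma integral_on_sphere (f : sphere R -> R) (M : R) : continuous f ->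
  (forall z, `|f z| <= M) ->
  (\int[on_sphere (reflection mu)]_z (f z)%:E =
   \int[mu]_(x in `[0%R, 1%R]) (f (Some (real_complex R (- x))))%:E)%E.
Proof.
move=> cf fM; have mf := continuous_borel_measurable cf.
have mf1 : measurable_fun setT (f \o sphere_of_real).
  by apply: measurableT_comp => //; exact: measurable_sphere_of_real.
have mf2 : measurable_fun setT (f \o sphere_of_real \o reflect_real).
  by apply: measurableT_comp => //; exact: measurable_reflect_real.
rewrite integral_distribution; last 2 first.
- exact/measurable_EFinP.
- exact: (bounded_integrable _ mf1 (fun x => fM _)).
rewrite integral_distribution; last 2 first.
- exact/measurable_EFinP.
- exact: (bounded_integrable _ mf2 (fun x => fM _)).
exact: (integral_on_full_set _ mu01 mf2).
Qed.

Lemma cauchy_transform_reflection t : 0 < t ->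
  (cauchy_transform (reflection mu) t)%:E =
  (\int[mu]_(x in `[0%R, 1%R]) (t + x)^-1%:E)%E.
Proof.
move=> t0.
have mi : measurable_fun [set: measurableTypeR R] (fun z : measurableTypeR R => (t - z)^-1).
  by apply: (measurableT_comp (@measurable_inv R)); exact: measurable_funB.
have mI : measurable (`[-1, 0]%classic : set (measurableTypeR R)) by exact: measurable_itv.
have I1 : reflection mu `[-1, 0]%classic = 1%E.
  rewrite -[RHS]mu01 /= /distribution /pushforward; congr (mu _).
  apply/seteqP; split => x; rewrite /= /reflect_real !in_itv/=; lra.
have e : (\int[reflection mu]_z ((t - z)^-1)%:E =
    \int[mu]_(x in `[0%R, 1%R]) (t + x)^-1%:E)%E.
  rewrite (integral_on_full_set mI I1 mi) integral_mkcond.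
  have -> : (fun z => ((t - z)^-1)%:E) \_ `[-1, 0] =
      (fun z : measurableTypeR R => (((fun z => (t - z)^-1) \_ `[-1, 0]) z)%:E).
    by apply/funext => z; rewrite !patchE; case: ifP.
  rewrite ge0_integral_distribution.
  - rewrite [RHS]integral_mkcond; apply: eq_integral => x _ /=.
    rewrite !patchE /reflect_real opprK !mem_setE.
    have -> : (- x \in `[-1, 0]) = (x \in `[0, 1]).
      by rewrite !in_itv/= lerN2 oppr_le0 andbC.
    by case: ifP.
  - by apply/measurable_EFinP/(measurable_restrictT _ mI)/measurable_funTS.
  - move=> z; rewrite lee_fin patchE; case: ifPn => //; rewrite mem_setE in_itv/=.
    by move=> /andP[_ z0]; rewrite invr_ge0; lra.
rewrite /cauchy_transform /Rintegral e fineK//.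
apply: integrable_fin_num => //.
apply: (@measurable_bounded_integrable _ _ _ mu (fun x => (t + x)^-1)) => //.
- by rewrite (le_lt_trans (probability_le1 _ _))// ltry.
- by apply: (measurableT_comp (@measurable_inv R)); exact: measurable_funD.
- exists t^-1; split; first exact: num_real.
  move=> N tN x /=; rewrite in_itv/= => /andP[x0 _].
  apply: le_trans (ltW tN); rewrite ger0_norm ?invr_ge0; last by lra.
  by rewrite lef_pV2 ?posrE; lra.
Qed.

Lemma mean_functional_integral :
  mean_functional (fun f => \int[mu]_(x in `[0, 1]) f x).
Proof.
have mI : measurable (`[0, 1]%classic : set (measurableTypeR R)) by exact: measurable_itv.
have integ f : continuous01 f -> mu.-integrable `[0, 1] (EFin \o f).
  move=> cf; apply: measurable_bounded_integrable => //.
  - by rewrite (le_lt_trans (probability_le1 _ _))// ltry.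
  - exact: subspace_continuous_measurable_fun.
  - have /compact_bounded : compact (f @` `[0, 1]).
      by apply: continuous_compact => //; exact: segment_compact.
    case=> B [Br HB]; exists B; split; first exact: Br.
    by move=> N BN x xI; apply: (HB N BN); exists x.
split=> [f g k cf cg|f M cf fM].
  have ig := integ _ cg.
  rewrite RintegralD//; [|exact: integ|exact: (integrableZl mI k ig)].
  by rewrite RintegralZl.
have M0 : 0 <= M.
  by apply: le_trans (fM 0 _); rewrite ?normr_ge0// lexx ler01.
rewrite (le_trans (le_normr_Rintegral _ (integ f cf)))//.
have -> : M = \int[mu]_(x in `[0, 1]) M.
  by rewrite Rintegral_cst//= mu01 /= mulr1.
apply: le_Rintegral => //; first exact: integrable_norm (integ f cf).
exact: finite_measure_integrable_cst.
Qed.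

End integrals_on_the_sphere.

Lemma mean_functional_average {R : realType} (s : seq R) : (0 < size s)%N ->
  all (fun z => 0 < z <= 1) s ->
  mean_functional (fun f => (size s)%:R^-1 * \sum_(z <- s) f z).
Proof.
move=> n0 /allP s01; have nR0 : (0 : R) < (size s)%:R by rewrite ltr0n.
split=> [f g k _ _|f M _ fM].
  by rewrite big_split /= -mulr_sumr; ring.
rewrite normrM gtr0_norm ?invr_gt0// mulrC ler_pdivrMr//.
rewrite (le_trans (ler_norm_sum _ _ _))//.
have -> : M * (size s)%:R = \sum_(z <- s) M.
  by rewrite big_const_seq count_predT iter_addr_0 mulr_natr.
rewrite !big_seq; apply: ler_sum => z /s01 /andP[z0 z1].
by rewrite fM// z1 ltW.
Qed.

(** Unique factorization over the complex numbers determines the multiset of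
    zeros. *)
Lemma zeros_opp_real {R : realType} (p : {poly R}) (s : seq R) (c : R) : c != 0 ->
  p = c *: \prod_(z <- s) ('X - z%:P) ->
  perm_eq (zeros (map_poly (real_complex R) (p \Po - 'X)))
    [seq real_complex R (- z) | z <- s].
Proof.
move=> c0 pE; set P := map_poly _ _.
have PE : P = (real_complex R (c * (-1) ^+ size s)) *:
    \prod_(z <- [seq real_complex R (- z) | z <- s]) ('X - z%:P).
  rewrite /P pE big_map.
  have -> : (c *: \prod_(z <- s) ('X - z%:P)) \Po - 'X =
      (c * (-1) ^+ size s) *: \prod_(z <- s) ('X - (- z)%:P).
    rewrite comp_polyZ rmorph_prod /= -scalerA; congr (_ *: _).
    elim: s {P pE} => [|z s IH]; first by rewrite !big_nil expr0 scale1r.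
    have e : ('X - z%:P) \Po - 'X = (-1) *: ('X - (- z)%:P).
      by rewrite comp_polyB comp_polyX comp_polyC scaleN1r polyCN; ring.
    by rewrite !big_cons IH exprS e -scalerAl -scalerAr scalerA.
  rewrite map_polyZ rmorph_prod; congr (_ *: _); apply: eq_bigr => z _.
  by rewrite rmorphB /= map_polyX map_polyC.
have cN0 : real_complex R (c * (-1) ^+ size s) != 0.
  by rewrite fmorph_eq0 mulf_neq0// signr_eq0.
have := svalP (closed_field_poly_normal P); rewrite -/(zeros P).
have lP : lead_coef P = real_complex R (c * (-1) ^+ size s).
  by rewrite PE lead_coefZ (monicP (monic_prod_XsubC _ _ _)) mulr1.
rewrite lP {1}PE => /(scalerI cN0) /esym; exact: prod_XsubC_eq.
Qed.

(** * The inverse function *)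
Section inverse_function.
Context {R : realType}.
Variables (lambda a : R).
Hypotheses (l0 : 0 < lambda) (a01 : 0 <= a <= 1).

(** With y = e^(- lambda alpha), the equation
    t = (1 - a y) (1 - y) / (b y - 1) is the quadratic equation
    a y^2 - (1 + a + b t) y + (1 + t) = 0. For 0 < alpha < 1 one has y <= 1, and
    the only root there is log_root_exp. *)
Lemma inverse_on_log_root :
  inverse_on `]0, 1[%classic `]0, +oo[%classic
    (fun alpha => (1 - a * expR (- lambda * alpha)) *
                  (1 - expR (- lambda * alpha)) /
                  (expR lambda * expR (- lambda * alpha) - 1))
    (fun t => lambda^-1 * log_root a (expR lambda) t).
Proof.
set b := expR lambda.
have b1 : 1 < b by rewrite expR_gt1.
have b1' : 1 <= b by exact: ltW.
have b0 : 0 < b by exact: expR_gt0.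
have lN0 : lambda != 0 by rewrite lt0r_neq0.
have [a0 a1] : 0 <= a /\ a <= 1 by case/andP: a01.
have ay y : y < 1 -> 0 < y -> 0 < 1 - a * y.
  by move=> y1 y0; rewrite subr_gt0 (le_lt_trans _ y1)// ler_piMl// ltW.
split=> [alpha|t]; rewrite /= !in_itv/= ?andbT.
- move=> /andP[al0 al1]; set y := expR (- lambda * alpha).
  have y0 : 0 < y by exact: expR_gt0.
  have y1 : y < 1 by rewrite /y -expR0 ltr_expR mulNr oppr_lt0 mulr_gt0.
  have by1 : 0 < b * y - 1.
    by rewrite /b /y -expRD subr_gt0 -expR0 ltr_expR mulNr subr_gt0 gtr_pMr.
  set t := _ / _.
  have t0 : 0 < t.
    by apply: divr_gt0 => //; apply: mulr_gt0; [exact: ay|rewrite subr_gt0].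
  split; first by [].
  have quad0 : `|1 + t - (1 + a + b * t) * y + a * y ^+ 2| <= 0.
    have -> : 1 + t - (1 + a + b * t) * y + a * y ^+ 2 =
      (1 - a * y) * (1 - y) - t * (b * y - 1) by ring.
    by rewrite /t divfK ?subrr ?normr0// lt0r_neq0.
  have := quad_root_dist a01 b1' t0 (ltW y1) quad0.
  rewrite mul0r normr_le0 subr_eq0 => /eqP yE.
  rewrite log_rootE// -yE expRK mulNr opprK mulKf//.
- move=> t0; set r := log_root_exp a b t.
  have r0 : 0 < r by exact: log_root_exp_gt0.
  have r1 : r <= 1 by exact: log_root_exp_le1.
  have E : - lambda * (lambda^-1 * log_root a b t) = ln r.
    by rewrite log_rootE// mulNr mulVKf// opprK.
  rewrite E lnK ?posrE//.
  have quad : (1 - a * r) * (1 - r) = t * (b * r - 1).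
    have := log_root_exp_quad a01 b1' t0 r; rewrite subrr mul0r => h.
    apply/eqP; rewrite -subr_eq0; apply/eqP; rewrite -h; ring.
  have r1' : r < 1.
    rewrite lt_neqAle r1 andbT; apply/eqP => rE.
    move: quad; rewrite rE subrr mulr0 => /esym/eqP.
    by rewrite mulf_eq0 !gt_eqF ?subr_gt0 ?mulr1.
  have br : 0 < b * r - 1.
    rewrite -(pmulr_rgt0 _ t0) -quad.
    by apply: mulr_gt0; [exact: ay|rewrite subr_gt0].
  split; last by rewrite quad mulfK// lt0r_neq0.
  apply/andP; split.
    by rewrite mulr_gt0 ?invr_gt0// log_rootE// oppr_gt0 ln_lt0// r0.
  rewrite mulrC ltr_pdivrMr// mul1r log_rootE// ltrNl -ltr_expR lnK ?posrE//.
  by rewrite expRN -/b -div1r ltr_pdivrMr// mulrC -subr_gt0.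
Qed.

End inverse_function.

(** * The limit of the zero distributions *)
Theorem mainTheorem6 (R : realType) (lambda a : R)
    (lambda_gt0 : 0 < lambda) (a01 : 0 <= a <= 1) :
  (forall (n : nat) (q x : R), 0 < q < 1 ->
    (little_qLaguerre n a q).[- x] =
      \sum_(0 <= k < n.+1)
        (\prod_(1 <= l < k.+1)
           ((q ^ (l%:Z - n%:Z) - q) / ((1 - a * q ^+ l) * (1 - q ^+ l)))) * x ^+ k)
  /\
  exists mu : probability (measurableTypeR R) R,
    [/\ mu `[0, +oo[%classic = 1%E,
        weakly_converges
          (fun n => empirical_zeros n (map_poly (real_complex R)
             (little_qLaguerre n a (expR (- lambda / n%:R)) \Po (- 'X))))
          (on_sphere (reflection mu)),
        inverse_on `]0, 1[%classic `]0, +oo[%classic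
          (fun alpha => (1 - a * expR (- lambda * alpha)) *
                        (1 - expR (- lambda * alpha)) /
                        (expR lambda * expR (- lambda * alpha) - 1))
          (fun t => t * cauchy_transform (reflection mu) t) &
        has_density mu (limit_density a lambda)].
Proof.
split; first by move=> n q x; exact: little_qLaguerre_explicit.
have [mu [mu_density mu01 mu_cauchy]] := limit_measure_ex a01 lambda_gt0.
have cauchyE t : 0 < t ->
    t * cauchy_transform (reflection mu) t = lambda^-1 * log_root a (expR lambda) t.
  move=> t0; apply: EFin_inj; rewrite -mu_cauchy// EFinM cauchy_transform_reflection//.
  rewrite -ge0_integralZl//.
  - apply/measurable_EFinP/measurable_funTS.
    by apply: (measurableT_comp (@measurable_inv R)); exact: measurable_funD.
  - move=> x /=; rewrite in_itv/= => /andP[x0 _].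
    by rewrite lee_fin invr_ge0 addr_ge0// ltW.
  - by rewrite lee_fin ltW.
exists mu; split => //.
- apply/eqP; rewrite eq_le probability_le1//= -mu01; apply: le_measure;
    rewrite ?inE//; exact: subset_itvl.
(* q = 1 for n = 0, where the choice of s is arbitrary *)
- have zerosP n : exists s, (0 < n)%N -> let q := expR (- (lambda / n%:R)) in
      [/\ size s = n, all (fun z => 0 < z) s, all (fun z => 0 < z <= 1) s &
        little_qLaguerre n a q =
        lead_coef (little_qLaguerre n a q) *: \prod_(z <- s) ('X - z%:P)].
    have [n0|_] := ltnP 0 n; last by exists [::].
    have q01 : 0 < expR (- (lambda / n%:R)) < 1.
      by rewrite expR_gt0 expR_lt1 oppr_lt0 divr_gt0 ?ltr0n.
    have [s [s1 s2 s3 s4]] := zeros_little_qLaguerre q01 n a01.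
    by exists s => _; split => //; exact: decay_le1 s3.
  have [s sP] := choice zerosP.
  move=> f cf [M fM].
  pose h x := f (Some (real_complex R (- x))).
  have ch : continuous h.
    have c1 : continuous (fun x : R => real_complex R (- x) : (R[i])^o).
      move=> x; apply: (@continuous_comp R R (R[i])^o (@GRing.opp R) (real_complex R)).
        by apply: (@cvgN _ R^o); exact: cvg_id.
      exact: continuous_real_complex.
    have c2 : continuous (fun x : R => Some (real_complex R (- x)) : sphere R).
      move=> x; apply: (@continuous_comp R (R[i])^o (sphere R)
        (fun x : R => real_complex R (- x)) Some); first exact: c1.
      exact: one_point_compactification_some_continuous.
    by move=> x; apply: (@continuous_comp R (sphere R) R _ f); [exact: c2|exact: cf].
  pose Ln n g : R := n%:R^-1 * \sum_(z <- s n) g z.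
  pose L (g : R -> R) := \int[mu]_(x in `[0, 1]) g x.
  have Lh : (\int[on_sphere (reflection mu)]_z (f z)%:E)%E = (L h)%:E.
    rewrite (integral_on_sphere mu01 cf fM) /L /Rintegral fineK//.
    apply: integrable_fin_num => //.
    apply: (integrableS measurableT) => //.
    by apply: (bounded_integrable _ _ (fun x => fM _)); exact: continuous_measurable_fun.
  have Lnh n : (0 < n)%N -> (\int[empirical_zeros n (map_poly (real_complex R)
        (little_qLaguerre n a (expR (- lambda / n%:R)) \Po (- 'X)))]_z (f z)%:E)%E =
      (Ln n h)%:E.
    move=> n0; have [s1 s2 s3 s4] := sP n n0; rewrite mulNr.
    have q01 : 0 < expR (- (lambda / n%:R)) < 1.
      by rewrite expR_gt0 expR_lt1 oppr_lt0 divr_gt0 ?ltr0n.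
    have szn := size_little_qLaguerre q01 n a01.
    have c0 : lead_coef (little_qLaguerre n a (expR (- (lambda / n%:R)))) != 0.
      by rewrite lead_coef_eq0 -size_poly_eq0 szn.
    rewrite integral_empirical_zeros//.
      rewrite (perm_big _ (zeros_opp_real c0 s4)) /=.
      by rewrite big_map.
    by rewrite size_map_poly size_comp_poly2 ?szn// size_polyN size_polyX.
  have -> : (\int[on_sphere (reflection mu)]_z (f z)%:E)%E = (L h)%:E by exact: Lh.
  apply: (@cvg_trans _ ((fun n => (Ln n h)%:E) @ \oo)).
    apply: near_eq_cvg; near=> n; rewrite Lnh//; near: n; by exists 1%N.
  apply/cvg_EFin; first by near=> n.
  apply: (@stieltjes_continuity R Ln L) => //.
  + near=> n; have n0 : (0 < n)%N by near: n; exists 1%N.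
    have [s1 s2 s3 s4] := sP n n0.
    by have := @mean_functional_average R (s n); rewrite s1; apply.
  + exact: mean_functional_integral.
  + move=> u u0; have uV0 : 0 < u^-1 by rewrite invr_gt0.
    (* also valid for 1 + u x = 0, where both sides are 0 *)
    have fracE x : (1 + u * x)^-1 = u^-1 / (u^-1 + x).
      by rewrite -invfM mulrDr mulfV// lt0r_neq0.
    have -> : L (fun x => (1 + u * x)^-1) = lambda^-1 * log_root a (expR lambda) u^-1.
      apply: EFin_inj; rewrite -mu_cauchy// /L /Rintegral fineK.
        by apply: eq_integral => x _; rewrite fracE.
      under eq_integral do rewrite fracE.
      by rewrite mu_cauchy.
    have -> : (fun n => Ln n (fun x => (1 + u * x)^-1)) =
        (fun n => n%:R^-1 * sum_frac (s n) u^-1).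
      by apply/funext => n; congr (_ * _); apply: eq_bigr => z _; exact: fracE.
    apply: (cvg_sum_frac lambda_gt0 a01 uV0) => n n0.
    by have [] := sP n n0.
- have [h1 h2] := inverse_on_log_root lambda_gt0 a01.
  split=> [al al01|t t0].
    have [h3 h4] := h1 _ al01; split=> //; rewrite cauchyE//.
    by move: h3; rewrite /= in_itv/= andbT.
  rewrite cauchyE; first exact: h2.
  by move: t0; rewrite /= in_itv/= andbT.
Unshelve. all: by end_near. Qed.
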